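(* Let $r\in(0,\infty)$, and let $\mu$ be the self-affine measure on a Lalley-Gatzouras carpet associated with the maps $(f_{ij})_{(i,j)\in G}$ and a positive probability vector $(p_{ij})_{(i,j)\in G}$. Let $s_r$ be the unique positive number satisfying $$\lim_{l\to\infty}\frac1l\log\sum_{\sigma\in\Psi_l}\big(p_{\sigma_L}q_{\sigma_R}a_{\sigma_L}^r\big)^{\frac{s_r}{s_r+r}}=0.$$ Then $0<\underline{Q}_r^{s_r}(\mu)\le\overline{Q}_r^{s_r}(\mu)<\infty$.
   Context: Setting. Let $m\ge2$ be an integer and let $n_j\ge1$ ($1\le j\le m$) be integers. Let $b_j,d_j$ ($1\le j\le m$) be positive numbers with $\sum_{j=1}^m b_j\le1$, $d_m\le1-b_m$, and $b_j+d_j\le d_{j+1}$ for $1\le j\le m-1$. Put $G=\{(i,j):1\le i\le n_j,\,1\le j\le m\}$ and $G_y=\{1,\ldots,m\}$. For $(i,j)\in G$ let $a_{ij}>0$ and $c_{ij}\ge0$ be such that for each $j$: $\sum_{i=1}^{n_j}a_{ij}\le1$, $\max_{1\le i\le n_j}a_{ij}<b_j$, $a_{n_jj}\le1-c_{n_jj}$, and $a_{ij}+c_{ij}\le c_{(i+1)j}$ for $1\le i\le n_j-1$. Let $f_{ij}(x,y)=(a_{ij}x+c_{ij},\,b_jy+d_j)$ on $\mathbb{R}^2$. The Lalley-Gatzouras carpet $E$ is the unique non-empty compact set with $E=\bigcup_{(i,j)\in G}f_{ij}(E)$. Given a probability vector $(p_{ij})_{(i,j)\in G}$ with all $p_{ij}>0$,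 $\mu$ is the unique Borel probability measure with $\mu=\sum_{(i,j)\in G}p_{ij}\,\mu\circ f_{ij}^{-1}$. Put $q_j=\sum_{i=1}^{n_j}p_{ij}$. Words. $G_y^*=\bigcup_{k\ge1}G_y^k$. For $\omega=((i_1,j_1),\ldots,(i_l,j_l))\in G^l$ and $\tau=(j_{l+1},\ldots,j_k)\in G_y^{k-l}$ ($k>l$) write $\sigma=\omega\ast\tau=((i_1,j_1),\ldots,(i_l,j_l),j_{l+1},\ldots,j_k)$, $\sigma_L=\omega$, $\sigma_R=\tau$, $\sigma_y=(j_1,\ldots,j_k)$, $\sigma_y^-=(j_1,\ldots,j_{k-1})$. Put $a_{\sigma_L}=\prod_{h=1}^la_{i_hj_h}$, $p_{\sigma_L}=\prod_{h=1}^lp_{i_hj_h}$, $q_{\sigma_R}=\prod_{h=l+1}^kq_{j_h}$, and $b_{\rho}=\prod_h b_{\rho_h}$ for a word $\rho=(\rho_1,\rho_2,\ldots)$ over $G_y$. For $l\ge1$, $$\Psi_l=\{\sigma=\sigma_L\ast\sigma_R:\ \sigma_L\in G^l,\ \sigma_R\in G_y^*,\ b_{\sigma_y^-}\ge a_{\sigma_L}>b_{\sigma_y}\}.$$ Quantization. For a Borel probability measure $\nu$ on $\mathbb{R}^d$ with $\int|x|^rd\nu(x)<\infty$, and $n\ge1$, $e_{n,r}(\nu)=\inf_{\alpha}\big(\int d(x,\alpha)^r\,d\nu(x)\big)^{1/r}$, the infimum being over all $\alpha\subset\mathbb{R}^d$ with $1\le\mathrm{card}(\alpha)\le n$, where $d(x,\alpha)=\inf_{y\in\alpha}|x-y|$.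 For $s>0$, $\overline{Q}_r^s(\nu)=\limsup_{n\to\infty}n^{r/s}e_{n,r}^r(\nu)$ and $\underline{Q}_r^s(\nu)=\liminf_{n\to\infty}n^{r/s}e_{n,r}^r(\nu)$. *)

(* Defs.v *)
From HB Require Import structures.
From mathcomp Require Import all_boot all_order all_algebra.
From mathcomp Require Import all_classical all_reals all_analysis.

Set Implicit Arguments.
Unset Strict Implicit.
Unset Printing Implicit Defensive.

Import Order.TTheory GRing.Theory Num.Theory.
Import numFieldNormedType.Exports.

Local Open Scope classical_set_scope.
Local Open Scope ring_scope.

(** The index set G: the paper's pair (i, j) is [idx i] with [i : 'I_(n j)], so
    that the column number j comes first; all indices start from 0. *)
Definition G (m : nat) (n : 'I_m -> nat) := {j : 'I_m & 'I_(n j)}.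

Definition idx (m : nat) (n : 'I_m -> nat) (j : 'I_m) (i : 'I_(n j)) : G n :=
  Tagged (fun j => 'I_(n j)) i.

Record lg_params (R : realType) (m : nat) (n : 'I_m -> nat)
    (a c : G n -> R) (b d : 'I_m -> R) : Prop := LgParams {
  lg_m : (2 <= m)%N ;
  lg_n : forall j, (1 <= n j)%N ;
  lg_b_gt0 : forall j, 0 < b j ;
  lg_d_gt0 : forall j, 0 < d j ;
  lg_b_sum : \sum_(j < m) b j <= 1 ;
  lg_d_last : forall j : 'I_m, j.+1 = m -> d j <= 1 - b j ;
  lg_d_next : forall j j' : 'I_m, j' = j.+1 :> nat -> b j + d j <= d j' ;
  lg_a_gt0 : forall g, 0 < a g ;
  lg_c_ge0 : forall g, 0 <= c g ;
  lg_a_sum : forall j, \sum_(i < n j) a (idx i) <= 1 ;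
  lg_a_lt_b : forall j (i : 'I_(n j)), a (idx i) < b j ;
  lg_c_last : forall j (i : 'I_(n j)), i.+1 = n j ->
    a (idx i) <= 1 - c (idx i) ;
  lg_c_next : forall j (i i' : 'I_(n j)), i' = i.+1 :> nat ->
    a (idx i) + c (idx i) <= c (idx i') }.

Definition lg_map (R : realType) (m : nat) (n : 'I_m -> nat)
    (a c : G n -> R) (b d : 'I_m -> R) (g : G n) (z : R * R) : R * R :=
  (a g * z.1 + c g, b (tag g) * z.2 + d (tag g)).

Definition is_carpet (R : realType) (m : nat) (n : 'I_m -> nat)
    (a c : G n -> R) (b d : 'I_m -> R) (E : set (R * R)) : Prop :=
  [/\ E !=set0, compact E & E = \bigcup_g (lg_map a c b d g @` E)].

Definition prob_vector (R : realType) (m : nat) (n : 'I_m -> nat)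
    (p : G n -> R) : Prop :=
  (forall g, 0 < p g) /\ \sum_g p g = 1.

(** The product sigma-algebra carried by this type is the Borel one of R^2. *)
Definition plane (R : realType) := (measurableTypeR R * measurableTypeR R)%type.

Definition self_affine (R : realType) (m : nat) (n : 'I_m -> nat)
    (a c : G n -> R) (b d : 'I_m -> R) (p : G n -> R)
    (mu : probability (plane R) R) : Prop :=
  forall A : set (plane R), measurable A ->
    mu A = (\sum_(g : G n) (p g)%:E * mu (lg_map a c b d g @^-1` A))%E.

Definition qvec (R : realType) (m : nat) (n : 'I_m -> nat) (p : G n -> R)
    (j : 'I_m) : R := \sum_(i < n j) p (idx i).

Definition wprod (R : realType) (T : Type) (u : T -> R) (w : seq T) : R :=
  \prod_(x <- w) u x.

(** A word sigma = sigma_L * sigma_R, with sigma_L in G^l, is the pair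
    (sigma_L, sigma_R). *)
Definition word_y (m : nat) (n : 'I_m -> nat) (l : nat)
    (sigma : l.-tuple (G n) * seq 'I_m) : seq 'I_m :=
  map tag sigma.1 ++ sigma.2.

Definition del_last (T : Type) (w : seq T) : seq T := take (size w).-1 w.

Definition Psi (R : realType) (m : nat) (n : 'I_m -> nat) (a : G n -> R)
    (b : 'I_m -> R) (l : nat) : set (l.-tuple (G n) * seq 'I_m) :=
  [set sigma | [/\ sigma.2 <> [::],
                   wprod b (word_y sigma) < wprod a sigma.1 &
                   wprod a sigma.1 <= wprod b (del_last (word_y sigma))]].

(** [Psi a b l] is finite (b < 1), so the finitely supported sum ranges over
    all of it. *)
Definition Psi_sum (R : realType) (m : nat) (n : 'I_m -> nat) (a : G n -> R)
    (b : 'I_m -> R) (p : G n -> R) (r s : R) (l : nat) : R :=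
  \sum_(sigma \in Psi a b (l := l))
    (wprod p sigma.1 * wprod (qvec p) sigma.2 * wprod a sigma.1 `^ r)
      `^ (s / (s + r)).

(** The product topology of the library comes with the sup norm, hence an
    explicit Euclidean distance. *)
Definition eucl_dist (R : realType) (x y : R * R) : R :=
  Num.sqrt ((x.1 - y.1) ^+ 2 + (x.2 - y.2) ^+ 2).

Definition dist_set (R : realType) (x : R * R) (alpha : set (R * R)) : R :=
  inf [set eucl_dist x y | y in alpha].

Definition quant_err (R : realType) (nu : probability (plane R) R) (r : R)
    (k : nat) : \bar R :=
  ereal_inf [set (\int[nu]_x ((dist_set x alpha) `^ r)%:E) `^ r^-1 |
              alpha in [set alpha : set (R * R) |
                         alpha !=set0 /\ (alpha #<= `I_k)%card]]%E.

Definition quant_seq (R : realType) (nu : probability (plane R) R) (r s : R)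
    (k : nat) : \bar R :=
  ((k%:R `^ (r / s))%R%:E * (quant_err nu r k) `^ r)%E.

Definition upper_quant_coeff (R : realType) (nu : probability (plane R) R)
    (r s : R) : \bar R := limn_esup (quant_seq nu r s).

Definition lower_quant_coeff (R : realType) (nu : probability (plane R) R)
    (r s : R) : \bar R := limn_einf (quant_seq nu r s).

(* Main.v *)
(** A word [s = (s_L, s_R)] of [Psi] describes an approximate square of the
    carpet, of width [a_{s_L}] comparable to its height [b_{s_y}], and
    [W s = p_{s_L} q_{s_R} a_{s_L}^r] is its contribution to the [r]-th power of
    the error.  With [t = s_r / (s_r + r)] it suffices to show that, for small
    [eta], the number of words with [W s] comparable to [eta] is comparable to
    [eta^-t].

    Choose [beta >= 0] such that [v_j = q_j^t b_j^beta] is a probability vector.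
    Then [W s ^ t] is comparable to [u_{s_L} v_{s_R}] on [Psi], where
    [u_ij = (p_ij a_ij^r)^t (b_j / a_ij)^beta], so the sum over [Psi_l] is
    comparable to [(sum u)^l], and the hypothesis on [s_r] says that [u] is a
    probability vector as well.  Geometrically the approximate squares form a
    tree in which [u_{s_L} v_{s_R}] is not additive.  But [Psi] is also a tree
    under the product order ([s_L] a prefix of [x] and [s_R] a prefix of [y], for
    independent words [x] of cells and [y] of columns), and there
    [u_{s_L} v_{s_R}] is the probability that [s] precedes [(x, y)].  Along every
    branch [W] decreases geometrically with bounded ratios, so each branch meets
    the band [W s ~ eta] at least once and at most [M] times; taking expectations
    gives the count.

    For the upper bound, every point of the carpet lies in a square of the band,
    and one corner per square is enough.  For the lower bound, squares of the band
    containing a common interior point form a chain of the geometric tree, so [N]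
    points meet the interior of at most [M N] of them, and each of the other
    squares contributes a fixed multiple of its weight. *)

Require Import Defs.
From HB Require Import structures.
From mathcomp Require Import all_boot all_order all_algebra.
From mathcomp Require Import all_classical all_reals all_analysis.
From mathcomp Require Import measurable_realfun ring lra zify.

Import Order.TTheory GRing.Theory Num.Theory.
Import numFieldNormedType.Exports.

Set Implicit Arguments.
Unset Strict Implicit.
Unset Printing Implicit Defensive.

Local Open Scope classical_set_scope.
Local Open Scope ring_scope.

(** * Words and weighted sums over words *)

Section Words.
Context {R : realType}.
Implicit Type T : Type.

Lemma wprod_nil T (u : T -> R) : wprod u [::] = 1.
Proof. by rewrite /wprod big_nil. Qed.

Lemma wprod_cons T (u : T -> R) x w : wprod u (x :: w) = u x * wprod u w.
Proof. by rewrite /wprod big_cons. Qed.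

Lemma wprod_cat T (u : T -> R) w w' :
  wprod u (w ++ w') = wprod u w * wprod u w'.
Proof. by rewrite /wprod big_cat. Qed.

Lemma wprod_seq1 T (u : T -> R) x : wprod u [:: x] = u x.
Proof. by rewrite /wprod big_seq1. Qed.

Lemma wprod_map T T' (f : T -> T') (u : T' -> R) w :
  wprod u (map f w) = wprod (u \o f) w.
Proof. by rewrite /wprod big_map. Qed.

Lemma wprodM T (u v : T -> R) w :
  wprod (fun x => u x * v x) w = wprod u w * wprod v w.
Proof. exact: big_split. Qed.

Lemma wprod_gt0 T (u : T -> R) w : (forall x, 0 < u x) -> 0 < wprod u w.
Proof. by move=> u0; apply: prodr_gt0. Qed.

Lemma le_wprod T (u v : T -> R) w :
  (forall x, 0 <= u x <= v x) -> wprod u w <= wprod v w.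
Proof. by move=> uv; apply: ler_prod => i _; exact: uv. Qed.

Lemma wprod_cst T (k : R) (w : seq T) : wprod (fun=> k) w = k ^+ size w.
Proof. by elim: w => [|x w IH]; rewrite ?wprod_nil ?expr0// wprod_cons IH exprS. Qed.

Lemma wprod_powR T (u : T -> R) (k : R) w : (forall x, 0 <= u x) ->
  wprod (fun x => u x `^ k) w = wprod u w `^ k.
Proof.
move=> u0; elim: w => [|x w IH]; first by rewrite !wprod_nil powR1.
by rewrite !wprod_cons IH powRM// prodr_ge0.
Qed.

Lemma wprod_le1 T (u : T -> R) w : (forall x, 0 < u x < 1) -> wprod u w <= 1.
Proof.
move=> u01; rewrite -(expr1n R (size w)) -wprod_cst.
by apply: le_wprod => x; case/andP: (u01 x) => /ltW -> /ltW ->.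
Qed.

Lemma wprod_prefix (T : eqType) (u : T -> R) w w' : (forall x, 0 < u x < 1) ->
  prefix w w' -> wprod u w' <= wprod u w.
Proof.
move=> u01 /prefixP[w'' ->]; rewrite wprod_cat ler_piMr ?wprod_le1//.
by apply/ltW/wprod_gt0 => x; case/andP: (u01 x).
Qed.

Lemma del_last_rcons T (w : seq T) x : del_last (rcons w x) = w.
Proof. by rewrite /del_last size_rcons /= -cats1 take_size_cat. Qed.

Lemma del_last_cat T (w w' : seq T) : w' <> [::] ->
  del_last (w ++ w') = w ++ del_last w'.
Proof.
case/lastP: w' => // w' x _.
by rewrite -rcons_cat !del_last_rcons.
Qed.

Lemma prefix_del_last (T : eqType) (w w' : seq T) :
  prefix w w' -> w != w' -> prefix w (del_last w').
Proof.
case/prefixP => s ->; case/lastP: s => [|s x]; first by rewrite cats0 eqxx.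
by move=> _; rewrite -rcons_cat del_last_rcons prefix_prefix.
Qed.

Lemma prefix_comparable (T : eqType) (w w' x : seq T) :
  prefix w x -> prefix w' x -> (size w <= size w')%N -> prefix w w'.
Proof.
rewrite !prefixE => /eqP wx /eqP w'x ww'.
by rewrite -w'x take_takel// wx.
Qed.

(** A stopping rule: with all [b x < 1], a word is read until the product of [b] first falls below
    [A]. *)
Definition crossing T (b : T -> R) (A : R) (Y : seq T) : bool :=
  [&& ~~ nilp Y, wprod b Y < A & A <= wprod b (del_last Y)].

(** A lower threshold is crossed no earlier: a proper prefix of [Y] is a prefix of [del_last Y],
    where the product is still at least [A], hence at least [A']. *)
Lemma crossing_prefix (T : eqType) (b : T -> R) A A' Y Y' :
  (forall x, 0 < b x < 1) -> A' <= A -> prefix Y Y' \/ prefix Y' Y ->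
  crossing b A Y -> crossing b A' Y' -> prefix Y Y'.
Proof.
move=> b01 AA' [//|Y'Y] /and3P[_ _ h1] /and3P[_ h2 _].
have [->|ne] := eqVneq Y' Y; first exact: prefix_refl.
have := wprod_prefix b01 (prefix_del_last Y'Y ne).
by move/(le_trans h1)/(le_trans AA'); rewrite leNgt h2.
Qed.

Lemma crossing_exists T (b : T -> R) A y : A <= 1 -> wprod b y < A ->
  exists k, crossing b A (take k y).
Proof.
move=> A1 yA.
have ex : exists k, (k <= size y)%N && (wprod b (take k y) < A).
  by exists (size y); rewrite leqnn take_size.
case: (ex_minnP ex) => k /andP[ky kA] kmin; exists k.
case: k => [|k] in ky kA kmin *.
  by move: kA; rewrite take0 wprod_nil ltNge A1.
apply/and3P; split => //.
- by rewrite /nilp size_take; case: ifP; case: (size y) ky.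
- rewrite /del_last size_takel//= take_takel//.
  by rewrite leNgt; apply/negP => h; have := kmin k; rewrite h (ltnW ky) ltnn => /(_ isT).
Qed.

Lemma crossing_lb T (b : T -> R) e A Y : (forall x, e <= b x) -> 0 < e ->
  0 <= A -> crossing b A Y -> e * A <= wprod b Y.
Proof.
move=> eb e0 A0 /and3P[]; case/lastP: Y => // Y x _ _.
rewrite del_last_rcons -cats1 wprod_cat wprod_seq1 => h.
by rewrite mulrC ler_pM// ltW.
Qed.

End Words.

Section WordSums.
Context {R : realType} (T : finType) (u : T -> R).

(** When [u] sums to 1 this is an expectation over [N] independent letters. Recursion on the first
    letter follows the way the invariance of [mu] unfolds. *)
Fixpoint wsum (N : nat) (F : seq T -> R) : R :=
  if N is N'.+1 then \sum_t u t * wsum N' (fun w => F (t :: w)) else F [::].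

Lemma wsumZ N k F : wsum N (fun w => k * F w) = k * wsum N F.
Proof.
elim: N F => [//|N IH] F /=; rewrite big_distrr/=.
by apply: eq_bigr => t _; rewrite IH; ring.
Qed.

Lemma wsum_sum N (I : Type) (r : seq I) (P : pred I) (F : I -> seq T -> R) :
  wsum N (fun w => \sum_(i <- r | P i) F i w) = \sum_(i <- r | P i) wsum N (F i).
Proof.
elim: N F => [//|N IH] F /=; rewrite exchange_big/=.
by apply: eq_bigr => t _; rewrite IH big_distrr.
Qed.

Lemma eq_wsum N F F' : (forall w, size w = N -> F w = F' w) ->
  wsum N F = wsum N F'.
Proof.
elim: N F F' => [|N IH] F F' h /=; first exact: h.
by apply: eq_bigr => t _; congr (_ * _); apply: IH => w wN; apply: h; rewrite /= wN.
Qed.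

Lemma wsum_tuple N (F : seq T -> R) :
  \sum_(w : N.-tuple T) wprod u w * F w = wsum N F.
Proof.
elim: N F => [|N IH] F /=.
  by rewrite (big_pred1 [tuple])//= ?wprod_nil ?mul1r// => t; rewrite (tuple0 t).
rewrite (reindex (fun p : T * N.-tuple T => cons_tuple p.1 p.2))/=; last first.
  exists (fun t => (thead t, behead_tuple t)) => [[x t] _|t _] /=.
    by congr (_, _); exact: val_inj.
  by apply: val_inj => /=; case: (tupleP t).
rewrite -(pair_big xpredT xpredT (fun x (t : N.-tuple T) =>
  wprod u (x :: t) * F (x :: t)))/=.
apply: eq_bigr => x _; rewrite -IH big_distrr/=.
by apply: eq_bigr => t _; rewrite wprod_cons; ring.
Qed.

Lemma wsum_exp N : wsum N (fun=> 1) = (\sum_t u t) ^+ N.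
Proof.
by elim: N => [|N IH] /=; rewrite ?expr0// exprS -IH big_distrl.
Qed.

Hypothesis u_ge0 : forall t, 0 <= u t.

Lemma le_wsum N F F' : (forall w, size w = N -> F w <= F' w) ->
  wsum N F <= wsum N F'.
Proof.
elim: N F F' => [|N IH] F F' h /=; first exact: h.
apply: ler_sum => t _; apply: ler_wpM2l => //.
by apply: IH => w wN; apply: h; rewrite /= wN.
Qed.

Hypothesis u_sum1 : \sum_t u t = 1.

Lemma wsum_cst N k : wsum N (fun=> k) = k.
Proof.
rewrite -(mulr1 k) (wsumZ _ _ (fun=> 1)) wsum_exp u_sum1.
by rewrite expr1n.
Qed.

Lemma wsum_prefix N w : (size w <= N)%N ->
  wsum N (fun x => (prefix w x)%:R) = wprod u w.
Proof.
elim: w N => [|t w IH] [|N]//= wN; rewrite ?wprod_nil//.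
  by rewrite -{2}u_sum1; apply: eq_bigr => t _; rewrite wsum_cst mulr1.
rewrite wprod_cons -(IH N wN) (bigD1 t)//= eqxx big1 ?addr0//.
move=> t' t't; rewrite (eq_wsum (F' := fun=> 0)) ?wsum_cst ?mulr0//.
by move=> x _; rewrite eq_sym (negbTE t't).
Qed.

End WordSums.

Section ColumnSums.
Context {R : realType} (T U : finType) (f : T -> U) (p : T -> R) (q : U -> R).
Hypothesis p_ge0 : forall t, 0 <= p t.
Hypothesis p_sum1 : \sum_t p t = 1.
Hypothesis qE : forall j, \sum_(t | f t == j) p t = q j.

(** This is the mass of an approximate square: beyond [w] only the columns are prescribed, and
    summing [p] over the cells of a column gives [q]. *)
Lemma wsum_prefix_map N w r : (size w + size r <= N)%N ->
  wsum p N (fun x => (prefix w x && prefix (map f w ++ r) (map f x))%:R) =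
  wprod p w * wprod q r.
Proof.
elim: w N => [|t w IH] N wN /=.
  rewrite wprod_nil mul1r; elim: r N wN => [|j r IH] N; rewrite ?wprod_nil ?wprod_cons.
    by move=> _; rewrite (@eq_wsum _ _ _ _ _ (fun=> 1)) ?wsum_cst// => x _; rewrite !prefix0s.
  case: N => [//|N]; rewrite add0n ltnS => rN /=.
  rewrite -qE big_distrl [RHS]big_mkcond/=; apply: eq_bigr => t _.
  case: ifPn => [/eqP <-|ne].
    rewrite -(IH N)//; by congr (_ * _); apply: eq_wsum => x _; rewrite eqxx/= prefix0s.
  rewrite (@eq_wsum _ _ _ _ _ (fun=> 0)) ?wsum_cst ?mulr0// => x _.
  by rewrite eq_sym (negbTE ne).
case: N wN => [//|N] wN /=.
rewrite wprod_cons -mulrA -(IH N)// (bigD1 t)//= [X in _ + X]big1 ?addr0.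
  by congr (_ * _); apply: eq_wsum => x _; rewrite !eqxx.
move=> t' t't; rewrite (@eq_wsum _ _ _ _ _ (fun=> 0)) ?wsum_cst ?mulr0// => x _.
by rewrite eq_sym (negbTE t't).
Qed.

End ColumnSums.

(** * Integrals against an invariant measure *)

Section InvariantMeasure.
Local Open Scope ereal_scope.
Context (R : realType) (d : measure_display) (T : measurableType d).
Context (mu : probability T R) (I : finType) (p : I -> R) (f : I -> T -> T).
Hypothesis p_ge0 : forall i, (0 <= p i)%R.
Hypothesis mf : forall i, measurable_fun setT (f i).
Hypothesis mu_inv : forall A, measurable A ->
  mu A = \sum_i (p i)%:E * mu (f i @^-1` A).

(** The invariance on sets identifies [mu] with a finite sum of scaled pushforwards, and the
    integral is additive in the measure. *)
Lemma integral_invariant (h : T -> \bar R) : measurable_fun setT h ->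
  (forall x, 0 <= h x) ->
  \int[mu]_x h x = \sum_i (p i)%:E * \int[mu]_x h (f i x).
Proof.
move=> mh h0.
(* [i0] is the default for listing [I] by numbers; an empty [I] would force [mu setT = 0]. *)
have [i0 _|I0] := pickP (@predT I); last first.
  by have := mu_inv measurableT; rewrite probability_setT big_pred0// => /eqP;
    rewrite onee_eq0.
pose mf_ i : {measure set T -> \bar R} :=
  measure_function_pushforward__canonical__measure_function_Measure mu (mf i).
pose m_ k : {measure set T -> \bar R} :=
  mscale (NngNum (p_ge0 (nth i0 (enum I) k))) (mf_ (nth i0 (enum I) k)).
have sumE (F : I -> \bar R) :
    \sum_(k < #|I|) F (nth i0 (enum I) k) = \sum_i F i.
  rewrite -(big_mkord xpredT (fun k => F (nth i0 (enum I) k))) cardE.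
  by rewrite -(big_nth i0 xpredT F) big_enum.
rewrite (eq_measure_integral (msum m_ #|I|)); last first.
  move=> A mA _; apply: (etrans (mu_inv mA)); rewrite -sumE.
  by apply: eq_bigr.
rewrite ge0_integral_measure_sum// -sumE; apply: eq_bigr => k _.
rewrite /m_ ge0_integral_mscale//; congr (_ * _).
by rewrite ge0_integral_pushforward.
Qed.

Definition word_map (w : seq I) (x : T) : T := foldr f x w.

Variable Q : set T.
Hypothesis mQ : measurable Q.
Hypothesis muQ : mu Q = 1.

Let aeQ : \forall x \ae mu, Q x.
Proof.
exists (~` Q); split; [exact: measurableC| |by []].
by rewrite probability_setC// muQ subee.
Qed.

(** Unfolding the invariance [N] times averages the integrals of [h] composed with [word_map w]; the
    pointwise bound is needed only on [Q], which has full measure. *)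
Lemma integral_ge_wsum N (h : T -> R) (lo : seq I -> R) :
  measurable_fun setT h -> (forall x, 0 <= h x)%R ->
  (forall w, 0 <= lo w)%R ->
  (forall w x, size w = N -> Q x -> (lo w <= h (word_map w x))%R) ->
  (wsum p N lo)%:E <= \int[mu]_x (h x)%:E.
Proof.
elim: N h lo => [|N IH] h lo mh h0 lo0 loh.
  rewrite -[leLHS]mule1 -(@probability_setT _ _ _ mu) -integral_cst//.
  apply: ae_ge0_le_integral => //=; try by move=> x _; rewrite lee_fin.
  - exact/measurable_EFinP.
  - by apply: filterS aeQ => x Qx _; rewrite lee_fin; exact: (loh [::]).
rewrite integral_invariant//; last exact/measurable_EFinP.
rewrite /= -sumEFin; apply: lee_sum => i _; rewrite EFinM.
apply: lee_wpmul2l; first by rewrite lee_fin.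
apply: (IH (h \o f i) (fun w => lo (i :: w))) => //=.
- exact: measurableT_comp.
- by move=> w x wN Qx; apply: (loh (i :: w)) => //=; rewrite wN.
Qed.

Lemma integral_le_wsum N (h : T -> R) (hi : seq I -> R) :
  measurable_fun setT h -> (forall x, 0 <= h x)%R ->
  (forall w, 0 <= hi w)%R ->
  (forall w x, size w = N -> Q x -> (h (word_map w x) <= hi w)%R) ->
  \int[mu]_x (h x)%:E <= (wsum p N hi)%:E.
Proof.
elim: N h hi => [|N IH] h hi mh h0 hi0 hhi.
  rewrite -[leRHS]mule1 -(@probability_setT _ _ _ mu) -integral_cst//.
  apply: ae_ge0_le_integral => //=; try by move=> x _; rewrite lee_fin.
  - exact/measurable_EFinP.
  - by apply: filterS aeQ => x Qx _; rewrite lee_fin; exact: (hhi [::]).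
rewrite integral_invariant//; last exact/measurable_EFinP.
rewrite /= -sumEFin; apply: lee_sum => i _; rewrite EFinM.
apply: lee_wpmul2l; first by rewrite lee_fin.
apply: (IH (h \o f i) (fun w => hi (i :: w))) => //=.
- exact: measurableT_comp.
- by move=> w x wN Qx; apply: (hhi (i :: w)) => //=; rewrite wN.
Qed.

End InvariantMeasure.

Section Support.
Local Open Scope ereal_scope.
Context (R : realType) (d : measure_display) (T : measurableType d).
Context (mu : probability T R) (I : finType) (p : I -> R) (f : I -> T -> T).
Hypothesis p_ge0 : forall i, (0 <= p i)%R.
Hypothesis p_sum1 : (\sum_i p i = 1)%R.
Hypothesis mf : forall i, measurable_fun setT (f i).
Hypothesis mu_inv : forall A, measurable A ->
  mu A = \sum_i (p i)%:E * mu (f i @^-1` A).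

(** [e x] plays the role of the distance from [x] to the support. *)
Lemma contracting_excess_ae0 (e : T -> R) (k : R) :
  measurable_fun setT e -> (0 <= k < 1)%R ->
  (forall i x t, (0 <= t)%R -> (e x <= t)%R -> (e (f i x) <= k * t)%R) ->
  mu [set x | (e x <= 0)%R] = 1.
Proof.
move=> me /andP[k0 k1] ef; pose Q t := [set x | (e x <= t)%R].
have mQ t : measurable (Q t).
  rewrite (_ : Q t = setT `&` e @^-1` `]-oo, t]%classic); first exact: me.
  by rewrite setTI; apply/seteqP; split => x /=; rewrite in_itv.
have QS t t' : (t <= t')%R -> Q t `<=` Q t'.
  by move=> tt' x; rewrite /Q/= => /le_trans; exact.
(* Each [f i] maps [Q t] into [Q (k * t)], so by invariance the smaller set carries at least as much
   mass. *)
have Qk t : (0 <= t)%R -> mu (Q t) <= mu (Q (k * t)%R).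
  move=> t0; rewrite (mu_inv (mQ (k * t)%R)).
  rewrite -[leLHS]mul1e -p_sum1 -sumEFin ge0_sume_distrl//; last first.
    by move=> i _; rewrite lee_fin.
  apply: lee_sum => i _; apply: lee_wpmul2l; first by rewrite lee_fin.
  apply: le_measure; rewrite ?inE//.
    by rewrite -[X in measurable X]setTI; exact: mf.
  by move=> x; exact: ef.
have Qkn t n : (0 <= t)%R -> mu (Q t) <= mu (Q (k ^+ n * t)%R).
  move=> t0; elim: n => [|n IH]; first by rewrite expr0 mul1r.
  by rewrite exprS -mulrA (le_trans IH)// Qk// mulr_ge0// exprn_ge0.
(* The sets [Q N] exhaust the space, and each has at most the mass of [Q (k ^+ n * N)], which lies
   in [Q s] for large [n]. *)
have Q1 : forall s, (0 < s)%R -> mu (Q s) = 1.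
  move=> s s0.
  have QN (N : nat) : mu (Q N%:R) <= mu (Q s).
    have : (fun n => k ^+ n * N%:R)%R @ \oo --> (0 * N%:R : R)%R.
      by apply: cvgMr_tmp; apply: cvg_expr; rewrite ger0_norm.
    rewrite mul0r => /cvgrPdist_lt /(_ s s0)[n _ /(_ n (leqnn n))] /=.
    rewrite sub0r normrN ger0_norm ?mulr_ge0 ?exprn_ge0// => /ltW kn.
    apply: (le_trans (Qkn _ n (ler0n _ N))).
    by apply: le_measure; rewrite ?inE//; exact: QS.
  have : mu (\bigcup_N Q N%:R) <= mu (Q s).
    have cv : mu \o (fun N => Q N%:R) @ \oo --> mu (\bigcup_N Q N%:R).
      apply: nondecreasing_cvg_mu => //; first exact: bigcup_measurable.
      by move=> n' m' nm; apply/subsetPset; apply: QS; rewrite ler_nat.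
    rewrite -(cvg_lim _ cv)//; apply: lime_le.
      by apply/cvg_ex; exists (mu (\bigcup_N Q N%:R)).
    by apply: nearW => N /=; exact: QN.
  rewrite (_ : \bigcup_N Q N%:R = setT) ?probability_setT.
    by move=> h; apply/eqP; rewrite eq_le h probability_le1.
  apply/seteqP; split => // x _; exists (Num.truncn `|e x|).+1 => //=.
  by rewrite /Q/= (le_trans (ler_norm _))// ltW// truncnS_gt.
have -> : [set x | (e x <= 0)%R] = \bigcap_n Q (n.+1%:R^-1)%R.
  apply/seteqP; split => x /=.
    by move=> h n _; rewrite /Q/= (le_trans h)// invr_ge0.
  move=> h; apply/ler_addgt0Pl => _/posnumP[t]; rewrite addr0.
  have := h (Num.truncn (t%:num^-1)) Logic.I; rewrite /Q/= => /le_trans; apply.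
  rewrite -[leRHS]invrK lef_pV2 ?posrE ?invr_gt0//.
  by rewrite ltW// truncnS_gt.
have cv : mu \o (fun n => Q (n.+1%:R^-1)%R) @ \oo --> mu (\bigcap_n Q (n.+1%:R^-1)%R).
  apply: nonincreasing_cvg_mu => //.
  - by apply: (le_lt_trans (probability_le1 mu (mQ _))); exact: ltry.
  - exact: bigcap_measurable.
  - move=> n' m' nm; apply/subsetPset; apply: QS.
    by rewrite lef_pV2 ?posrE// ler_nat.
rewrite -(cvg_lim _ cv)//; apply: cvg_lim => //.
rewrite (_ : mu \o _ = fun=> 1); first exact: cvg_cst.
by apply/funext => n /=; rewrite Q1// invr_gt0.
Qed.

End Support.

(** * Euclidean distance to finite sets of points *)

Section Distance.
Context {R : realType}.

Lemma eucl_dist_ge0 (x y : R * R) : 0 <= eucl_dist x y.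
Proof. exact: sqrtr_ge0. Qed.

Lemma eucl_dist_le (x y : R * R) k1 k2 : `|x.1 - y.1| <= k1 ->
  `|x.2 - y.2| <= k2 -> eucl_dist x y <= k1 + k2.
Proof.
move=> h1 h2; have k10 := le_trans (normr_ge0 _) h1.
have k20 := le_trans (normr_ge0 _) h2.
rewrite /eucl_dist -[leRHS]ger0_norm ?addr_ge0// -sqrtr_sqr ler_wsqrtr//.
have sq (z k : R) : `|z| <= k -> z ^+ 2 <= k ^+ 2.
  move=> zk; rewrite -real_normK ?num_real// ler_pXn2r ?nnegrE//.
  exact: le_trans zk.
have := mulr_ge0 k10 k20; move: (sq _ _ h1) (sq _ _ h2); rewrite sqrrD; lra.
Qed.

Lemma eucl_dist_ge (x y : R * R) k : 0 <= k ->
  k <= `|x.1 - y.1| \/ k <= `|x.2 - y.2| -> k <= eucl_dist x y.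
Proof.
move=> k0 h; rewrite /eucl_dist -[leLHS]ger0_norm// -sqrtr_sqr ler_wsqrtr//.
have sq (z : R) : k <= `|z| -> k ^+ 2 <= z ^+ 2.
  by move=> kz; rewrite -[leRHS]real_normK ?num_real// ler_pXn2r ?nnegrE.
have := sqr_ge0 (x.1 - y.1); have := sqr_ge0 (x.2 - y.2).
by case: h => /sq; lra.
Qed.

Lemma dist_set_le (x y : R * R) (alpha : set (R * R)) : alpha y ->
  dist_set x alpha <= eucl_dist x y.
Proof.
move=> ay; apply: ge_inf; last by exists y.
by exists 0 => _ [z _ <-]; exact: eucl_dist_ge0.
Qed.

Lemma le_dist_set (x : R * R) (alpha : set (R * R)) k : alpha !=set0 ->
  (forall y, alpha y -> k <= eucl_dist x y) -> k <= dist_set x alpha.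
Proof.
move=> [y ay] h; apply: lb_le_inf; first by exists (eucl_dist x y), y.
by move=> _ [z az <-]; exact: h.
Qed.

Lemma dist_set_ge0 (x : R * R) (alpha : set (R * R)) : alpha !=set0 ->
  0 <= dist_set x alpha.
Proof. by move=> /le_dist_set; apply=> y _; exact: eucl_dist_ge0. Qed.

Lemma measurable_eucl_dist (y : R * R) :
  measurable_fun setT (fun x : plane R => eucl_dist x y).
Proof.
rewrite (_ : (fun _ => _) = fun x : plane R =>
  ((x.1 - y.1) ^+ 2 + (x.2 - y.2) ^+ 2) `^ 2^-1).
  apply: (measurableT_comp (measurable_powR 2^-1)).
  by apply: measurable_funD; apply: measurable_funX; apply: measurable_funB.
by apply/funext => x; rewrite powR12_sqrt// addr_ge0// sqr_ge0.
Qed.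

(** Listing [alpha] turns the infimum into an iterated minimum; the fold starts at the distance to a
    point of [alpha], which leaves the minimum unchanged. *)
Lemma measurable_dist_set (alpha : set (R * R)) : alpha !=set0 ->
  finite_set alpha ->
  measurable_fun setT (fun x : plane R => dist_set x alpha).
Proof.
move=> a0 /finite_seqP[s sE].
pose m (x : R * R) := foldr (fun y (e : R) => Num.min (eucl_dist x y) e).
have mle x e y : y \in s -> m x e s <= eucl_dist x y.
  elim: s {sE} => // z s IH; rewrite inE ge_min => /orP[/eqP ->|/IH ->].
    by rewrite lexx.
  by rewrite orbT.
have mlb x e k : k <= e -> (forall y, y \in s -> k <= eucl_dist x y) ->
    k <= m x e s.
  move=> ke; elim: s {sE mle} => // z s IH h /=; rewrite le_min h ?mem_head//=.
  by apply: IH => y ys; apply: h; rewrite inE ys orbT.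
have [y0 ay0] := a0.
have y0s : y0 \in s by move: ay0; rewrite sE.
rewrite (_ : (fun _ => _) = fun x : plane R => m x (eucl_dist x y0) s).
  elim: s {sE mle mlb y0s} => [|y s IH] /=; first exact: measurable_eucl_dist.
  by apply: measurable_minr => //; exact: measurable_eucl_dist.
apply/funext => x; apply/eqP; rewrite eq_le; apply/andP; split.
  by apply: mlb => [|y ys]; apply: dist_set_le => //; rewrite sE.
by apply: le_dist_set => // y; rewrite sE => ys; exact: mle.
Qed.

End Distance.

(** * Approximate squares *)

(** If two levels differed by [M] or more, the decay by [xi] per level would take the weight out of
    the band. So all levels lie in a window of length [M], with at most one element each. *)
Lemma leq_card_chain (R : realType) (T : finType) (S : {pred T}) (l : T -> nat)
    (W : T -> R) (xi lo hi : R) (M : nat) :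
  0 < xi <= 1 -> 0 <= hi -> xi ^+ M * hi <= lo ->
  (forall s, s \in S -> lo <= W s < hi) ->
  (forall s s', s \in S -> s' \in S -> (l s <= l s')%N ->
    W s' <= xi ^+ (l s' - l s) * W s) ->
  {in S &, injective l} -> (#|S| <= M)%N.
Proof.
move=> /andP[xi0 xi1] hi0 Mlo SW chain inj.
have dl s s' : s \in S -> s' \in S -> (l s <= l s')%N -> (l s' - l s < M)%N.
  move=> Ss Ss' ll; rewrite ltnNge; apply/negP => Ml.
  have /andP[lo1 _] := SW _ Ss'; have /andP[_ hi2] := SW _ Ss.
  have := chain _ _ Ss Ss' ll.
  have h : xi ^+ (l s' - l s) * W s < xi ^+ (l s' - l s) * hi.
    by rewrite ltr_pM2l// exprn_gt0.
  have := ler_wpM2r hi0 (ler_wiXn2l (ltW xi0) xi1 Ml); lra.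
case: M Mlo dl => [|M] Mlo dl.
  by rewrite leqn0; apply/eqP/eq_card0 => s; apply/negP => Ss; have := dl s s Ss Ss (leqnn _).
(* Levels that differ by less than [M.+1] are determined by their residues. *)
pose g s : 'I_M.+1 := inord (l s %% M.+1).
rewrite -(card_in_image (f := g)); last first.
  move=> s s' Ss Ss' /(congr1 val); rewrite /= !inordK ?ltn_mod// => ls.
  apply: inj => //.
  have [ll|/ltnW ll] := leqP (l s) (l s').
    move/eqP: ls; rewrite eq_sym eqn_mod_dvd// => /dvdn_leq.
    by have := dl _ _ Ss Ss' ll; lia.
  move/eqP: ls; rewrite eqn_mod_dvd// => /dvdn_leq.
  by have := dl _ _ Ss' Ss ll; lia.
by rewrite -[leqRHS]card_ord max_card.
Qed.

(** A discrete intermediate value argument: the weight starts at or above [eta], ends below it, and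
    the step that takes it below loses at most a factor [c0]. *)
Lemma first_passage (R : realType) (X : Type) (rel : nat -> X -> Prop) (W : X -> R)
    (c0 eta : R) (L : nat) :
  (forall l, (l <= L)%N -> exists s, rel l s) ->
  (forall l s s', rel l s -> rel l.+1 s' -> c0 * W s <= W s') ->
  (forall s, rel 0 s -> eta <= W s) -> (forall s, rel L s -> W s < eta) ->
  0 <= c0 ->
  exists l s, [/\ (l <= L)%N, rel l s & c0 * eta <= W s < eta].
Proof.
move=> ex step top bot c00.
have [s0 rs0] := ex _ (leqnn L).
elim: L s0 ex bot rs0 => [|L IH] s' ex bot rs'.
  by have := top _ rs'; rewrite leNgt bot.
have [s rs] := ex _ (leqnSn L).
have [etas|seta] := lerP eta (W s).
  exists L.+1, s'; split=> //; rewrite bot// andbT.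
  by rewrite (le_trans _ (step _ _ _ rs rs'))// ler_wpM2l.
(* [rel] need not be a function, so another element of level [L] may lie above [eta]. If none does,
   the whole level is below and the induction applies. *)
have [|/forallNP h] := pselect (exists s1, rel L s1 /\ eta <= W s1).
  case=> s1 [rs1 etas1]; exists L.+1, s'; split=> //; rewrite bot// andbT.
  by rewrite (le_trans _ (step _ _ _ rs1 rs'))// ler_wpM2l.
have [||l [s1 [lL rs1 Ws1]]] := IH s _ _ rs.
- by move=> l lL; apply: ex; lia.
- by move=> s1 rs1; rewrite ltNge; apply/negP => ?; case: (h s1).
- by exists l, s1; split => //; lia.
Qed.

(** [T] is the set of cells, [U] the set of columns, [f] the column of a cell;
    [e] is a common lower bound for all the quantities that have to stay away
    from 0. *)
Record column_system (R : realType) (T U : finType) (f : T -> U)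
    (a : T -> R) (b : U -> R) (p : T -> R) (q : U -> R) (e : R) : Prop :=
  ColumnSystem {
  cs_e : 0 < e < 1 ;
  cs_a : forall t, e <= a t <= (1 - e) * b (f t) ;
  cs_b : forall j, e <= b j <= 1 - e ;
  cs_p : forall t, e <= p t ;
  cs_q : forall j, e <= q j <= 1 - e ;
  cs_p1 : \sum_t p t = 1 ;
  cs_pq : forall j, \sum_(t | f t == j) p t = q j }.

Section ApproximateSquares.
Context {R : realType} {T U : finType} (f : T -> U).
Context (a : T -> R) (b : U -> R) (p : T -> R) (q : U -> R) (e r : R).
Hypothesis cs : column_system f a b p q e.
Hypothesis r_gt0 : 0 < r.
Implicit Types s : seq T * seq U.

Let e0 : 0 < e. Proof. by case/andP: (cs_e cs). Qed.
Let e1 : e < 1. Proof. by case/andP: (cs_e cs). Qed.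
Let b01 j : 0 < b j < 1. Proof. by have := cs_b cs j; have := e0; lra. Qed.
Let q01 j : 0 < q j < 1. Proof. by have := cs_q cs j; have := e0; lra. Qed.
Let b0 j : 0 < b j. Proof. by case/andP: (b01 j). Qed.
Let q0 j : 0 < q j. Proof. by case/andP: (q01 j). Qed.
Let p0 t : 0 < p t. Proof. exact: lt_le_trans (cs_p cs t). Qed.
Let a0 t : 0 < a t. Proof. by have := cs_a cs t; have := e0; lra. Qed.
Let a1 t : a t <= 1 - e.
Proof. by have := cs_a cs t; have := cs_b cs (f t); have := e0; nra. Qed.
Let a01 t : 0 < a t < 1. Proof. by have := a0 t; have := a1 t; have := e0; lra. Qed.
Let pq t : p t <= q (f t).
Proof.
rewrite -(cs_pq cs) (bigD1 t)//= lerDl; apply: sumr_ge0 => i _; exact: ltW.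
Qed.
Let p01 t : 0 < p t < 1.
Proof. by rewrite p0 (le_lt_trans (pq t))//; case/andP: (q01 (f t)). Qed.

Let wa0 w : 0 <= wprod a w. Proof. exact/ltW/wprod_gt0. Qed.
Let wp0 w : 0 <= wprod p w. Proof. exact/ltW/wprod_gt0. Qed.
Let wb0 y : 0 <= wprod b y. Proof. exact/ltW/wprod_gt0. Qed.
Let wq0 y : 0 <= wprod q y. Proof. exact/ltW/wprod_gt0. Qed.

Definition sq_word s : seq U := map f s.1 ++ s.2.

(** Membership in [Psi] with the level [size s.1] left free. *)
Definition sq s : bool :=
  ~~ nilp s.2 && crossing b (wprod a s.1) (sq_word s).

Definition sq_weight s : R := wprod p s.1 * wprod q s.2 * wprod a s.1 `^ r.

Definition sq_ratio (w : seq T) : R := wprod a w / wprod b (map f w).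

(** The stopping rule for [s_R] depends on [s_L] through a number only, so that
    [s_R] may be read along a word of columns independent of [s_L]. *)
Lemma sqE s : sq s = crossing b (sq_ratio s.1) s.2.
Proof.
have b0' := wprod_gt0 (map f s.1) b0.
rewrite /sq /crossing /sq_word; case: (@nilP _ s.2) => //= s20.
rewrite del_last_cat// !wprod_cat ltr_pdivlMr// ler_pdivrMr//.
rewrite ![_ * wprod b (map f _)]mulrC.
by case: (s.2) s20 => //= j y _; rewrite /nilp size_cat/= addnS.
Qed.

Lemma sq_ratio_cons t w : sq_ratio (t :: w) = a t / b (f t) * sq_ratio w.
Proof. by rewrite /sq_ratio /= !wprod_cons invfM; ring. Qed.

Lemma ratio_bounds t : e <= a t / b (f t) <= 1 - e.
Proof.
rewrite ler_pdivlMr// ler_pdivrMr//; have /andP[h ->] := cs_a cs t.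
rewrite andbT (le_trans _ h)// ger_pMr//; by case/andP: (b01 (f t)) => _ /ltW.
Qed.

Lemma sq_ratio_bounds w : e ^+ size w <= sq_ratio w <= (1 - e) ^+ size w.
Proof.
elim: w => [|t w /andP[h1 h2]]; first by rewrite /sq_ratio !wprod_nil divr1 lexx.
rewrite sq_ratio_cons !exprS; have /andP[h3 h4] := ratio_bounds t.
have := exprn_ge0 (size w) (ltW e0) => h5.
by rewrite !ler_pM ?(ltW e0) ?(le_trans (ltW e0) h3) ?(le_trans h5 h1).
Qed.

Lemma sq_ratio_gt0 w : 0 < sq_ratio w.
Proof. by apply: divr_gt0; exact: wprod_gt0. Qed.

Lemma sq_ratio_le1 w : sq_ratio w <= 1.
Proof.
have /andP[_ h] := sq_ratio_bounds w; apply: le_trans h _.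
by apply: exprn_ile1; have := e0; have := e1; lra.
Qed.

Lemma sq_ratio_cat w w' : sq_ratio (w ++ w') = sq_ratio w * sq_ratio w'.
Proof. by rewrite /sq_ratio map_cat !wprod_cat invfM; ring. Qed.

Lemma sq_ratio_prefix w w' : prefix w w' -> sq_ratio w' <= sq_ratio w.
Proof.
move=> /prefixP[w'' ->]; rewrite sq_ratio_cat ler_piMr ?sq_ratio_le1//.
exact/ltW/sq_ratio_gt0.
Qed.

(** Up to its last letter the tail has a [b]-product of at least [sq_ratio s.1], hence at least
    [e ^+ L], while each column contributes at most [1 - e]. Words of bounded level thus fit in a
    finite type. *)
Lemma sq_size L K s : (1 - e) ^+ K < e ^+ L -> (size s.1 <= L)%N -> sq s ->
  (size s.2 <= K)%N.
Proof.
move=> KL sL; rewrite sqE => /and3P[]; case/lastP: (s.2) => // y x _ _.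
rewrite del_last_rcons size_rcons => h.
rewrite ltnNge; apply/negP => Ky.
have /andP[h1 _] := sq_ratio_bounds s.1.
have h2 : e ^+ L <= e ^+ size s.1 by apply: ler_wiXn2l => //; exact: ltW.
have h3 : wprod b y <= (1 - e) ^+ size y.
  rewrite -wprod_cst; apply: le_wprod => j; have := cs_b cs j; have := b0 j; lra.
have h4 : (1 - e) ^+ size y <= (1 - e) ^+ K.
  by apply: ler_wiXn2l => //; have := e1; have := e0; lra.
lra.
Qed.

(** Before its last letter [z] loses at most a factor [e] in [b]. As
    [b j ^+ k <= (1 - e) ^+ k <= e <= q j], this is a loss of at most [e ^+ k] in [q]; the last
    letter costs one more [e]. *)
Lemma wprod_q_extension k A A' y z : (1 - e) ^+ k <= e ->
  wprod b y < A -> e * A <= A' -> crossing b A' (y ++ z) ->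
  e ^+ k.+1 <= wprod q z.
Proof.
move=> ke yA AA' /and3P[_ _]; case/lastP: z => [|z x].
  by rewrite wprod_nil => _; apply: exprn_ile1; exact: ltW.
rewrite -rcons_cat del_last_rcons -cats1 !wprod_cat wprod_seq1 => h.
have yb := wprod_gt0 y b0.
have ez : e <= wprod b z by rewrite -(ler_pM2l yb); have := e0; nra.
rewrite exprSr ler_pM ?exprn_ge0 ?(ltW e0)//; last by case/andP: (cs_q cs x).
have : wprod b z ^+ k <= wprod q z.
  rewrite /wprod -prodrXl; apply: ler_prod => j _.
  rewrite exprn_ge0 ?(ltW (b0 j))//=; have /andP[h1 _] := cs_q cs j.
  apply: le_trans h1; apply: le_trans ke; apply: lerXn2r.
  - by rewrite nnegrE ltW.
  - by rewrite nnegrE; have := e1; lra.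
  - by case/andP: (cs_b cs j).
by apply: le_trans; apply: lerXn2r; rewrite ?nnegrE ?(ltW e0) ?(ltW (wprod_gt0 _ b0)).
Qed.

Lemma sq_weight_gt0 s : 0 < sq_weight s.
Proof. by rewrite !mulr_gt0 ?powR_gt0 ?wprod_gt0. Qed.

(** Bounds the loss of weight from one level to the next: the factors account for the new [p], the
    change of [q], and the new [a] to the power [r]. *)
Definition step_cst (k : nat) : R := e * e ^+ k.+1 * e `^ r.

Lemma step_cst_gt0 k : 0 < step_cst k.
Proof. by rewrite !mulr_gt0 ?powR_gt0 ?exprn_gt0. Qed.

Lemma sq_weight_step k w t y z (c : R) : 0 < c -> e ^+ k.+1 <= c ->
  wprod q z = wprod q y * c ->
  step_cst k * sq_weight (w, y) <= sq_weight (rcons w t, z).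
Proof.
move=> c0 kc zE; rewrite /step_cst /sq_weight /= -cats1 !wprod_cat !wprod_seq1 zE.
rewrite powRM ?wa0 ?(ltW (a0 t))//.
rewrite [leLHS](_ : _ = wprod p w * wprod q y * wprod a w `^ r *
  (e * e ^+ k.+1 * e `^ r)); last by ring.
rewrite [leRHS](_ : _ = wprod p w * wprod q y * wprod a w `^ r *
  (p t * c * a t `^ r)); last by ring.
rewrite ler_pM2l; last exact: (sq_weight_gt0 (w, y)).
apply: ler_pM; rewrite ?mulr_ge0 ?exprn_ge0 ?powR_ge0 ?(ltW e0)//.
  by apply: ler_pM => //; rewrite ?exprn_ge0 ?(ltW e0)//; exact: (cs_p cs).
apply: ge0_ler_powR; rewrite ?nnegrE ?(ltW r_gt0) ?(ltW e0) ?(ltW (a0 t))//.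
by case/andP: (cs_a cs t).
Qed.

(** [free] refers to the product order, [geo] to the inclusion of squares. *)
Lemma sq_step_free k w t y z : (1 - e) ^+ k <= e -> sq (w, y) ->
  sq (rcons w t, z) -> prefix y z ->
  step_cst k * sq_weight (w, y) <= sq_weight (rcons w t, z).
Proof.
move=> ke; rewrite !sqE /= => /and3P[_ yw _] yz /prefixP[z' zE].
apply: (@sq_weight_step k _ _ _ _ (wprod q z')); first exact: wprod_gt0.
  apply: (wprod_q_extension ke yw _ (A' := sq_ratio (rcons w t))); last by rewrite -zE.
  rewrite -cats1 sq_ratio_cat mulrC ler_pM2l ?sq_ratio_gt0//.
  by rewrite /sq_ratio /= !wprod_seq1; case/andP: (ratio_bounds t).
by rewrite zE wprod_cat.
Qed.

(** Here [f t :: z = y ++ z']: the column of the new cell leaves the tail, so [q] changes by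
    [wprod q z' / q (f t)], and dividing by a number below 1 only helps. *)
Lemma sq_step_geo k w t y z : (1 - e) ^+ k <= e -> sq (w, y) ->
  sq (rcons w t, z) -> prefix (sq_word (w, y)) (sq_word (rcons w t, z)) ->
  step_cst k * sq_weight (w, y) <= sq_weight (rcons w t, z).
Proof.
move=> ke /andP[_ /and3P[_ yw _]] /andP[_ yz] /prefixP[z' zE].
have zE' : f t :: z = y ++ z'.
  move: zE; rewrite /sq_word /= map_rcons cat_rcons -catA.
  by move/eqP; rewrite eqseq_cat// eqxx => /eqP.
apply: (@sq_weight_step k _ _ _ _ (wprod q z' / q (f t))).
- by rewrite divr_gt0// wprod_gt0.
- rewrite ler_pdivlMr// (@le_trans _ _ (e ^+ k.+1))//.
    by rewrite ger_pMr ?exprn_gt0//; case/andP: (q01 (f t)) => _ /ltW.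
  apply: (wprod_q_extension ke yw _ (A' := wprod a (rcons w t))); last by rewrite -zE.
  rewrite -cats1 wprod_cat mulrC ler_pM2l ?wprod_gt0// wprod_seq1.
  by case/andP: (cs_a cs t).
- by rewrite mulrA -wprod_cat -zE' wprod_cons mulrC mulKf// gt_eqF.
Qed.

Definition decay : R := (1 - e) `^ r.

Lemma decay_gt0 : 0 < decay. Proof. by rewrite powR_gt0// subr_gt0. Qed.

Lemma decay_lt1 : decay < 1.
Proof.
rewrite (_ : 1 = 1 `^ r); last by rewrite powR1.
apply: gt0_ltr_powR; rewrite ?nnegrE ?ler01//.
  by have := e1; lra.
by have := e0; lra.
Qed.

Lemma wprod_a_decay w : wprod a w `^ r <= decay ^+ size w.
Proof.
rewrite -powR_mulrn ?powR_ge0// -powRrM mulrC powRrM powR_mulrn; last first.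
  by have := e1; lra.
apply: ge0_ler_powR; rewrite ?nnegrE ?(ltW r_gt0) ?exprn_ge0 ?subr_ge0 ?(ltW e1)//.
rewrite -wprod_cst; by apply: le_wprod => t; rewrite a1 ltW.
Qed.

Lemma sq_weight_decay w w' y z (c : R) : c <= wprod q y -> 0 <= c ->
  wprod p w' * wprod q z = c ->
  sq_weight (w ++ w', z) <= decay ^+ size w' * sq_weight (w, y).
Proof.
move=> cy c0 cE; rewrite /sq_weight /= !wprod_cat powRM//.
rewrite [leLHS](_ : _ = wprod p w * wprod a w `^ r *
  ((wprod p w' * wprod q z) * wprod a w' `^ r)); last by ring.
rewrite [leRHS](_ : _ = wprod p w * wprod a w `^ r *
  (wprod q y * decay ^+ size w')); last by ring.
rewrite ler_pM2l ?mulr_gt0 ?powR_gt0 ?wprod_gt0// cE.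
by rewrite ler_pM ?powR_ge0 ?wprod_a_decay.
Qed.

Lemma sq_decay_free w w' y z : prefix y z ->
  sq_weight (w ++ w', z) <= decay ^+ size w' * sq_weight (w, y).
Proof.
move=> yz; apply: sq_weight_decay (erefl _); last first.
  exact: mulr_ge0.
apply: le_trans (wprod_prefix q01 yz).
by rewrite ler_piMl ?wprod_le1.
Qed.

(** As [p t <= q (f t)], replacing [p] by [q] on [w'] bounds the new mass factor by
    [wprod q (y ++ z')], hence by [wprod q y]. *)
Lemma sq_decay_geo w w' y z :
  prefix (sq_word (w, y)) (sq_word (w ++ w', z)) ->
  sq_weight (w ++ w', z) <= decay ^+ size w' * sq_weight (w, y).
Proof.
move=> /prefixP[z' zE].
have zE' : map f w' ++ z = y ++ z'.
  move: zE; rewrite /sq_word /= map_cat -!catA.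
  by move/eqP; rewrite eqseq_cat// eqxx => /eqP.
apply: sq_weight_decay (erefl _); last exact: mulr_ge0.
rewrite (@le_trans _ _ (wprod q (map f w') * wprod q z))//.
  rewrite ler_pM2r ?wprod_gt0// wprod_map.
  by apply: le_wprod => t /=; rewrite pq (ltW (p0 t)).
by rewrite -wprod_cat zE' wprod_cat ler_piMr ?wprod_le1.
Qed.

(** At level 0 the threshold is 1, so the tail is a single column and the weight is its [q]. *)
Lemma sq_weight_top s : sq s -> size s.1 = 0%N -> e <= sq_weight s.
Proof.
rewrite sqE => + /eqP/nilP w0; rewrite /sq_weight w0 !wprod_nil powR1 mul1r mulr1.
have -> : sq_ratio [::] = 1 by rewrite /sq_ratio !wprod_nil divr1.
move=> /and3P[]; case/lastP: (s.2) => // y x _ _; rewrite del_last_rcons.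
case: y => [|j y] h; first by rewrite wprod_seq1; case/andP: (cs_q cs x).
have /andP[_ h1] := b01 j.
have := wprod_le1 y b01; have := wprod_gt0 y b0; have := b0 j.
by move: h; rewrite wprod_cons; nra.
Qed.

Lemma sq_weight_le s : sq_weight s <= decay ^+ size s.1.
Proof.
rewrite /sq_weight -[leRHS]mul1r ler_pM ?powR_ge0 ?wprod_a_decay//.
  exact: mulr_ge0.
by rewrite -[leRHS]mulr1 ler_pM ?wprod_le1.
Qed.

Lemma sq_chain_free w w' y z x : sq (w, y) -> sq (w', z) -> prefix w w' ->
  prefix y x -> prefix z x -> prefix y z.
Proof.
rewrite !sqE /= => wy wz ww' yx zx.
apply: (crossing_prefix b01 (sq_ratio_prefix ww')) wy wz.
have [h|/ltnW h] := leqP (size y) (size z).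
  by left; exact: (prefix_comparable yx zx).
by right; exact: (prefix_comparable zx yx).
Qed.

Lemma sq_chain_geo s s' : sq s -> sq s' -> prefix s.1 s'.1 ->
  prefix (sq_word s) (sq_word s') \/ prefix (sq_word s') (sq_word s) ->
  prefix (sq_word s) (sq_word s').
Proof.
move=> /andP[_ h] /andP[_ h'] ww' c.
exact: (crossing_prefix b01 (wprod_prefix a01 ww')) h h'.
Qed.

(** Take the first [l] cells of [x] and read [y] until the threshold is crossed; [K] is large enough
    for this at every level up to [L]. *)
Lemma sq_free_ex L K x y l : (1 - e) ^+ K < e ^+ L -> size x = L ->
  (K <= size y)%N -> (l <= L)%N ->
  exists s, [/\ sq s, size s.1 = l, prefix s.1 x & prefix s.2 y].
Proof.
move=> KL xL Ky lL.
have [|k h] := @crossing_exists _ _ b (sq_ratio (take l x)) y (sq_ratio_le1 _).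
  apply: (@le_lt_trans _ _ ((1 - e) ^+ K)).
    apply: (@le_trans _ _ ((1 - e) ^+ size y)).
      by rewrite -wprod_cst; apply: le_wprod => j; have := cs_b cs j; have := b0 j; lra.
    by apply: ler_wiXn2l => //; have := e1; have := e0; lra.
  apply: (lt_le_trans KL); have /andP[h _] := sq_ratio_bounds (take l x).
  apply: le_trans h; apply: (ler_wiXn2l (ltW e0) (ltW e1)).
  by rewrite size_takel ?xL.
exists (take l x, take k y); split; rewrite ?prefix_take ?sqE//=.
by rewrite size_takel// xL.
Qed.

Lemma sq_geo_ex L K w l : (1 - e) ^+ K < e ^+ L -> (L <= size w)%N ->
  (K <= size w)%N -> (l <= L)%N ->
  exists s, [/\ sq s, size s.1 = l, prefix s.1 w & prefix (sq_word s) (map f w)].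
Proof.
move=> KL Lw Kw lL.
have szw : size (take l w) = l by rewrite size_takel// (leq_trans lL).
have [||k h] := @crossing_exists _ _ b (wprod a (take l w)) (map f w).
- exact: wprod_le1.
- apply: (@le_lt_trans _ _ ((1 - e) ^+ K)).
    apply: (@le_trans _ _ ((1 - e) ^+ size (map f w))).
      by rewrite -wprod_cst; apply: le_wprod => j; have := cs_b cs j; have := b0 j; lra.
    by rewrite size_map; apply: ler_wiXn2l => //; have := e1; have := e0; lra.
  apply: (lt_le_trans KL); apply: (@le_trans _ _ (e ^+ l)).
    by apply: (ler_wiXn2l (ltW e0) (ltW e1)).

  rewrite -[in leLHS]szw -wprod_cst; apply: le_wprod => t.
  by rewrite (ltW e0)/=; case/andP: (cs_a cs t).
set Y := take k (map f w) in h *.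
have Yw : prefix Y (map f w) by exact: prefix_take.
have lw : prefix (map f (take l w)) (map f w) by rewrite map_take prefix_take.
(* As [a] is below [b] cell by cell, the first [l] columns do not cross yet, so the tail is not
   empty. *)
have lY : (l < size Y)%N.
  rewrite ltnNge; apply/negP => Yl; case/and3P: h => _ + _.
  rewrite ltNge => /negP; apply.
  have : prefix Y (map f (take l w)).
    by apply: prefix_comparable Yw lw _; rewrite size_map szw.
  move/(wprod_prefix b01); apply: le_trans.
  rewrite wprod_map; apply: le_wprod => t /=; rewrite (ltW (a0 t))/=.
  have /andP[_ h] := cs_a cs t; apply: le_trans h _.
  by have := b0 (f t); have := e0; nra.
have E : map f (take l w) ++ drop l Y = Y.
  have : prefix (map f (take l w)) Y.
    by apply: prefix_comparable lw Yw _; rewrite size_map szw ltnW.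
  by rewrite prefixE size_map szw => /eqP <-; rewrite cat_take_drop.
exists (take l w, drop l Y); split; rewrite ?prefix_take ?szw//=.
- by rewrite /sq /sq_word /= E h andbT /nilp size_drop subn_eq0 -ltnNge.
- by rewrite /sq_word /= E.
Qed.

End ApproximateSquares.

Lemma expr_lt_ex (R : realType) (x eps : R) : 0 <= x < 1 -> 0 < eps ->
  exists n, x ^+ n < eps.
Proof.
move=> /andP[x0 x1] eps0.
have x1' : `|x| < 1 by rewrite ger0_norm.
have /cvgrPdist_lt /(_ _ eps0)[n _ /(_ n (leqnn n))] /= := cvg_expr x1'.
by rewrite sub0r normrN ger0_norm ?exprn_ge0//; exists n.
Qed.

(** * Counting approximate squares *)

Section Counting.
Context {R : realType} {T U : finType} (f : T -> U).
Context (a : T -> R) (b : U -> R) (p : T -> R) (q : U -> R) (e r : R).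
Hypothesis cs : column_system f a b p q e.
Hypothesis r_gt0 : 0 < r.

Let e0 : 0 < e. Proof. by case/andP: (cs_e cs). Qed.
Let e1 : e < 1. Proof. by case/andP: (cs_e cs). Qed.

Local Notation sq := (sq f a b).
Local Notation W := (sq_weight a p q r).

(** A tail shorter than [h] has a [b]-product of at least [e ^+ h], and [sq_ratio s.1] must exceed
    it. This bounds the level as well, and then the weight is bounded below. *)
Lemma long_tail (h : nat) : exists2 eta : R, 0 < eta &
  forall s, sq s -> W s < eta -> (h <= size s.2)%N.
Proof.
have [||l1 hl1] := @expr_lt_ex _ (1 - e) (e ^+ h).
- by have := e0; have := e1; lra.
- by rewrite exprn_gt0.
exists (e ^+ l1 * e ^+ h * (e ^+ l1) `^ r).
  by rewrite !mulr_gt0 ?powR_gt0 ?exprn_gt0.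
move=> s ss Ws; rewrite leqNgt; apply/negP => sh; move: Ws; rewrite ltNge => /negP; apply.
have lexp (X : Type) (g : X -> R) (w : seq X) n : (forall x, e <= g x) ->
    (size w <= n)%N -> e ^+ n <= wprod g w.
  move=> eg wn; apply: (@le_trans _ _ (e ^+ size w)).
    by apply: (ler_wiXn2l (ltW e0) (ltW e1)).
  by rewrite -wprod_cst; apply: le_wprod => x; rewrite eg (ltW e0).
have sl : (size s.1 <= l1)%N.
  rewrite leqNgt; apply/negP => l1s.
  move: ss; rewrite (sqE cs) => /and3P[_ + _]; apply/negP; rewrite -leNgt.
  have /andP[_ h1] := sq_ratio_bounds cs s.1; apply: (le_trans h1).
  apply: (@le_trans _ _ ((1 - e) ^+ l1)).
    by apply: ler_wiXn2l; rewrite ?(ltnW l1s)//; have := e0; have := e1; lra.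
  apply: (le_trans (ltW hl1)); apply: lexp (ltnW sh) => j.
  by case/andP: (cs_b cs j).
have ea : e ^+ l1 <= wprod a s.1.
  by apply: lexp sl => t; case/andP: (cs_a cs t).
apply: ler_pM; rewrite ?mulr_ge0 ?powR_ge0 ?exprn_ge0 ?(ltW e0)//.
  apply: ler_pM; rewrite ?exprn_ge0 ?(ltW e0)//.
    exact: (lexp _ _ _ _ (cs_p cs) sl).
  by apply: lexp (ltnW sh) => j; case/andP: (cs_q cs j).
apply: ge0_ler_powR; rewrite ?nnegrE ?(ltW r_gt0) ?exprn_ge0 ?(ltW e0)//.
by apply: le_trans ea; rewrite exprn_ge0// ltW.
Qed.

Context (k : nat).
Hypothesis ke : (1 - e) ^+ k <= e.

(** The band is as wide as the loss allowed in one step, so no branch can jump over it. *)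
Definition in_band (eta : R) s : bool :=
  sq s && (step_cst e r k * eta <= W s < eta).

Lemma geo_band_ex L K (eta : R) w : 0 < eta <= e -> (1 - e) ^+ K < e ^+ L ->
  decay e r ^+ L < eta -> (L <= size w)%N -> (K <= size w)%N ->
  exists s, [/\ (size s.1 <= L)%N, in_band eta s, prefix s.1 w
    & prefix (sq_word f s) (map f w)].
Proof.
move=> /andP[eta0 etae] KL Leta Lw Kw.
pose rel l s := [/\ sq s, size s.1 = l, prefix s.1 w &
  prefix (sq_word f s) (map f w)].
have [|||||l [s [lL [ss sl sw yw] Ws]]] :=
    @first_passage R _ rel W (step_cst e r k) eta L.
- by move=> l lL; exact: (sq_geo_ex cs KL).
- move=> l [w1 y1] [w2 y2] [/= s1 l1 p1 pp1] [/= s2 l2 p2 pp2].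
  have w12 : prefix w1 w2 by apply: prefix_comparable p1 p2 _; rewrite l1 l2.
  case/prefixP: w12 l2 s2 p2 pp2 => w3 ->; rewrite size_cat l1 -addn1 => /addnI.
  case: w3 => [//|t [_|//]]; rewrite cats1 => s2 p2 pp2; apply: (sq_step_geo cs r_gt0 ke s1 s2).
  apply: (sq_chain_geo cs s1 s2); first exact: prefix_rcons.
  have [h|/ltnW h] := leqP (size (sq_word f (w1, y1))) (size (sq_word f (rcons w1 t, y2))).
    by left; exact: (prefix_comparable pp1 pp2).
  by right; exact: (prefix_comparable pp2 pp1).
- by move=> s [s1 l1 _ _]; by apply: (le_trans etae); apply: (sq_weight_top r cs).
- move=> s [s1 l1 _ _]; apply: le_lt_trans Leta.
  by rewrite -l1; apply: (sq_weight_le cs r_gt0).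
- exact/ltW/(step_cst_gt0 r cs k).
by exists s; split; rewrite // ?sl// /in_band ss Ws.
Qed.

Section Kraft.
Context (u : T -> R) (v : U -> R) (t : R) (L K : nat).
Hypotheses (u_ge0 : forall x, 0 <= u x) (v_ge0 : forall x, 0 <= v x).
Hypotheses (u_sum1 : \sum_x u x = 1) (v_sum1 : \sum_x v x = 1).
Hypothesis t_ge0 : 0 <= t.

Local Notation sq_code := (L.-bseq T * K.-bseq U)%type.

Definition decode (s : sq_code) : seq T * seq U := (val s.1, val s.2).

Lemma decode_inj : injective decode.
Proof. by move=> [s1 s2] [s1' s2'] [/val_inj -> /val_inj ->]. Qed.

Lemma decode_ex (s : seq T * seq U) : (size s.1 <= L)%N -> (size s.2 <= K)%N ->
  exists s', decode s' = s.
Proof.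
by case: s => s1 s2 /= h1 h2; exists (Bseq h1, Bseq h2).
Qed.

Lemma kraftE (s : sq_code) :
  wprod u (decode s).1 * wprod v (decode s).2 =
  wsum u L (fun x => wsum v K (fun y =>
    (prefix (decode s).1 x && prefix (decode s).2 y)%:R)).
Proof.
transitivity (wsum u L (fun x => wprod v (decode s).2 * (prefix (decode s).1 x)%:R)).
  by rewrite wsumZ wsum_prefix ?size_bseq// mulrC.
apply: eq_wsum => x _.
rewrite -(wsum_prefix v_sum1 (size_bseq s.2)) mulrC -wsumZ.
by apply: eq_wsum => y _; rewrite -natrM mulnb.
Qed.

(** By [kraftE] each term is the probability that the word precedes a random pair [(x, y)] in the
    product order; summing gives the expected number of such words. *)
Lemma kraft_sum (S : pred sq_code) :
  \sum_(s | S s) wprod u (decode s).1 * wprod v (decode s).2 =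
  wsum u L (fun x => wsum v K (fun y => #|[pred s | S s &&
    (prefix (decode s).1 x && prefix (decode s).2 y)]|%:R)).
Proof.
under eq_bigr => s _ do rewrite kraftE.
rewrite -wsum_sum; apply: eq_wsum => x _; rewrite -wsum_sum; apply: eq_wsum => y _.
by rewrite -sum1_card natr_sum big_mkcondr; apply: eq_bigr => s _; case: ifP.
Qed.

(** The masses of the band words are bounded below, while at most [M] of these words precede any
    given pair, since they form a chain of decaying weights. *)
Lemma card_band_le M (eta cl : R) : 0 < eta -> decay e r ^+ M <= step_cst e r k ->
  0 <= cl -> (forall s, sq s -> cl * W s `^ t <= wprod u s.1 * wprod v s.2) ->
  #|[pred s : sq_code | in_band eta (decode s)]|%:R *
    (cl * (step_cst e r k * eta) `^ t) <= M%:R.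
Proof.
move=> eta0 Mc cl0 lam.
have c0 := step_cst_gt0 r cs k.
apply: (@le_trans _ _ (\sum_(s : sq_code | in_band eta (decode s))
    wprod u (decode s).1 * wprod v (decode s).2)).
  rewrite -sum1_card natr_sum big_distrl/=; apply: ler_sum => s /andP[ss /andP[Ws _]].
  rewrite mul1r; apply: le_trans (lam _ ss); apply: ler_wpM2l => //.
  by apply: ge0_ler_powR => //; rewrite nnegrE ltW ?(sq_weight_gt0 r cs)// mulr_gt0.
rewrite kraft_sum -[leRHS](wsum_cst u_sum1 L).
apply: le_wsum => // x _; rewrite -[leRHS](wsum_cst v_sum1 K).
apply: le_wsum => // y _; rewrite ler_nat.
apply: (@leq_card_chain R _ _ (fun s => size (decode s).1) (fun s => W (decode s))
  (decay e r) (step_cst e r k * eta) eta M).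
- by rewrite (decay_gt0 r cs)//= ltW// (decay_lt1 cs r_gt0).
- exact: ltW.
- by rewrite ler_pM2r.
- by move=> s; rewrite inE => /andP[/andP[]].
- move=> s s'; rewrite !inE => /and3P[/andP[ss _] px py] /and3P[/andP[ss' _] px' py'] ll.
  have xx := prefix_comparable px px' ll.
  have := sq_chain_free cs (w := (decode s).1) (w' := (decode s').1) ss ss' xx py py'.
  case/prefixP: xx => w' E; rewrite E size_cat addKn => yy.
  rewrite (_ : decode s' = ((decode s).1 ++ w', (decode s').2)); last by rewrite -E.
  exact: (sq_decay_free cs r_gt0).
- move=> s s'; rewrite !inE => /and3P[/andP[ss _] px py] /and3P[/andP[ss' _] px' py'] ll.
  apply: decode_inj.
  have xx : (decode s).1 = (decode s').1.
    move: px px'; rewrite !prefixE => /eqP <- /eqP <-.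
    by rewrite ll.
  have h1 := @sq_chain_free _ _ _ _ _ _ _ _ _ cs (decode s).1 (decode s').1 (decode s).2 (decode s').2 y ss ss'.
  have h2 := @sq_chain_free _ _ _ _ _ _ _ _ _ cs (decode s').1 (decode s).1 (decode s').2 (decode s).2 y ss' ss.
  rewrite xx prefix_refl in h1 h2.
  have {}h1 := h1 isT py py'; have {}h2 := h2 isT py' py.
  rewrite [decode s]surjective_pairing [decode s']surjective_pairing xx; congr (_, _).
  move: h1; rewrite prefixE => /eqP <-.
  by rewrite take_oversize// size_prefix.
Qed.

(** The prefix [h] imposed on [s_R] costs a constant factor only; it is used to
    keep the columns after [s_L] compatible with a cell lying in the interior. *)
Lemma card_band_ge (eta : R) (h : seq U) : 0 < eta <= e -> (1 - e) ^+ K < e ^+ L ->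
  decay e r ^+ L < eta -> (size h <= K)%N ->
  (forall s, sq s -> W s < eta -> (size h <= size s.2)%N) ->
  (forall s, sq s -> wprod u s.1 * wprod v s.2 <= W s `^ t) ->
  wprod v h <= #|[pred s : sq_code | in_band eta (decode s) &&
                   prefix h (decode s).2]|%:R * eta `^ t.
Proof.
move=> /andP[eta0 etae] KL Leta hK tail lam.
apply: (@le_trans _ _ (\sum_(s : sq_code | in_band eta (decode s) && prefix h (decode s).2)
    wprod u (decode s).1 * wprod v (decode s).2)); last first.
  rewrite -sum1_card natr_sum big_distrl/=; apply: ler_sum => s /andP[/andP[ss /andP[_ Ws]] _].
  rewrite mul1r; apply: (le_trans (lam _ ss)).
  by apply: ge0_ler_powR; rewrite ?nnegrE ?(ltW eta0) ?(ltW Ws) ?(ltW (sq_weight_gt0 r cs _)).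
(* The event that [h] is a prefix of [y] has probability [wprod v h], and on it some band word with
   tail extending [h] precedes [(x, y)]. *)
rewrite kraft_sum -[leLHS](wsum_cst u_sum1 L).
apply: le_wsum => // x xL; rewrite -(wsum_prefix v_sum1 hK).
apply: le_wsum => // y yK; rewrite ler_nat.
case hy: (prefix h y) => //=; apply/card_gt0P.
pose rel l s := [/\ sq s, size s.1 = l, prefix s.1 x & prefix s.2 y].
have [|||||l [s [lL [ss sl sx sy] Ws]]] :=
    @first_passage R _ rel W (step_cst e r k) eta L.
- by move=> l lL; apply: (sq_free_ex cs KL) => //; rewrite yK.
- move=> l [w1 y1] [w2 y2] [/= s1 l1 p1 pp1] [/= s2 l2 p2 pp2].
  have w12 : prefix w1 w2 by apply: prefix_comparable p1 p2 _; rewrite l1 l2.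
  case/prefixP: w12 l2 s2 p2 pp2 => w3 ->; rewrite size_cat l1 -addn1 => /addnI.
  case: w3 => [//|z [_|//]]; rewrite cats1 => s2 p2 pp2; apply: (sq_step_free cs r_gt0 ke s1 s2).
  exact: (sq_chain_free cs s1 s2 (prefix_rcons _ _) pp1 pp2).
- by move=> s [s1 l1 _ _]; by apply: (le_trans etae); apply: (sq_weight_top r cs).
- move=> s [s1 l1 _ _]; apply: le_lt_trans Leta.
  by rewrite -l1; apply: (sq_weight_le cs r_gt0).
- exact/ltW/(step_cst_gt0 r cs k).
have [||s' s'E] := @decode_ex s; first by rewrite sl.
  by rewrite -yK; exact: size_prefix.
have /andP[_ Wlt] := Ws.
(* [tail] makes [s.2] at least as long as [h], and both are prefixes of [y]. *)
have hs := prefix_comparable hy sy (tail _ ss Wlt).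
move: ss sx sy Ws hs; rewrite -s'E => ss sx sy Ws hs.
exists s'; rewrite inE; apply/and3P; split => //.
by rewrite [X in _ && X]hs andbT; apply/andP.
Qed.

End Kraft.

End Counting.

(** * The probability vectors on columns and on cells *)

Lemma powR_wcontinuous (R : realType) (x : R) : 0 < x -> continuous (powR x).
Proof.
move=> x0 y; rewrite (_ : powR x = fun z => expR (z * ln x)).
  apply: continuous_comp; last exact: continuous_expR.
  by apply: cvgMr_tmp; exact: cvg_id.
by apply/funext => z; rewrite /powR gt_eqF.
Qed.

Section PressureMeasures.
Context {R : realType} {T U : finType} (f : T -> U).
Context (a : T -> R) (b : U -> R) (p : T -> R) (q : U -> R) (e r t : R).
Hypothesis cs : column_system f a b p q e.
Hypothesis r_gt0 : 0 < r.
Hypothesis t01 : 0 < t < 1.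

Let e0 : 0 < e. Proof. by case/andP: (cs_e cs). Qed.
Let e1 : e < 1. Proof. by case/andP: (cs_e cs). Qed.
Let b0 j : 0 < b j. Proof. by have := cs_b cs j; have := e0; lra. Qed.
Let q0 j : 0 < q j. Proof. by have := cs_q cs j; have := e0; lra. Qed.
Let p0 x : 0 < p x. Proof. exact: lt_le_trans (cs_p cs x). Qed.
Let a0 x : 0 < a x. Proof. by have := cs_a cs x; have := e0; lra. Qed.
Let t0 : 0 < t. Proof. by case/andP: t01. Qed.

Local Notation sq := (sq f a b).
Local Notation W := (sq_weight a p q r).

(** Intermediate value theorem in [beta]: at 0 the sum is at least that of [q], which is 1, because
    [q <= 1] and [t < 1]; at a large integer [N] it is at most [Q * (1 - e) ^+ N <= 1]. *)
Lemma column_exponent_ex :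
  exists2 beta, 0 <= beta & \sum_j q j `^ t * b j `^ beta = 1.
Proof.
pose g beta := \sum_j q j `^ t * b j `^ beta.
have q1 : \sum_j q j = 1.
  rewrite -(cs_p1 cs) (partition_big f xpredT)//=.
  by apply: eq_bigr => j _; rewrite (cs_pq cs).
pose Q := \sum_j q j `^ t.
have Q1 : 1 <= Q.
  rewrite -q1; apply: ler_sum => j _; apply: ger1_powR.
    by rewrite q0/= (le_trans (andP (cs_q cs j)).2)// ltW// ltrBlDr ltrDl.
  by case/andP: t01 => _ /ltW.
have [||N hN] := @expr_lt_ex R (1 - e) Q^-1.
- by have := e0; have := e1; lra.
- by rewrite invr_gt0; lra.
have [||beta betaN gbeta] := @IVT R g 0 N%:R 1 (ler0n _ _).
- apply: continuous_subspaceT; apply: (continuous_big add_continuous) => j _ x.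
  by apply: cvgMl_tmp; exact: powR_wcontinuous.
- rewrite ge_min le_max; apply/andP; split; apply/orP; [right|left]; rewrite /g.
    apply: (@le_trans _ _ (\sum_j q j `^ t * (1 - e) ^+ N)).
      apply: ler_sum => j _; apply: ler_wpM2l; first exact: powR_ge0.
      rewrite powR_mulrn ?(ltW (b0 j))//; apply: lerXn2r; rewrite ?nnegrE ?(ltW (b0 j))//.
        by have := e1; lra.
      by case/andP: (cs_b cs j).
    rewrite -big_distrl/= -/Q mulrC -ler_pdivlMr ?mul1r ?ltW//; lra.
  by under eq_bigr do rewrite powRr0 mulr1.
by exists beta => //; move: betaN; rewrite in_itv/= => /andP[].
Qed.

Context (beta : R).
Hypothesis beta_ge0 : 0 <= beta.
Hypothesis beta_eq : \sum_j q j `^ t * b j `^ beta = 1.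

Definition col_mass (j : U) : R := q j `^ t * b j `^ beta.

Definition cell_mass (x : T) : R :=
  (p x * a x `^ r) `^ t * (b (f x) / a x) `^ beta.

Lemma col_mass_ge0 j : 0 <= col_mass j.
Proof. by rewrite mulr_ge0 ?powR_ge0. Qed.

Lemma col_mass_gt0 j : 0 < col_mass j.
Proof. by rewrite mulr_gt0 ?powR_gt0. Qed.

Lemma cell_mass_ge0 x : 0 <= cell_mass x.
Proof. by rewrite mulr_ge0 ?powR_ge0. Qed.

Lemma cell_mass_gt0 x : 0 < cell_mass x.
Proof. by rewrite mulr_gt0 ?powR_gt0 ?mulr_gt0 ?powR_gt0 ?invr_gt0. Qed.

(** Besides the power of the weight there remains a power of the height of the square over
    [wprod a s.1], a quotient that the stopping rule keeps between [e] and 1. *)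
Lemma massE s : wprod cell_mass s.1 * wprod col_mass s.2 =
  W s `^ t * (wprod b s.2 / sq_ratio f a b s.1) `^ beta.
Proof.
have wa0 := wprod_gt0 s.1 a0; have wb0 := wprod_gt0 s.2 b0.
have wp0 := wprod_gt0 s.1 p0; have wq0 := wprod_gt0 s.2 q0.
have wbf0 := wprod_gt0 (map f s.1) b0.
rewrite /cell_mass /col_mass !wprodM.
rewrite (wprod_powR (u := fun x => p x * a x `^ r)) ?wprodM; last first.
  by move=> x; rewrite mulr_ge0 ?powR_ge0 ?(ltW (p0 x)).
rewrite (wprod_powR (u := fun x => b (f x) / a x)); last first.
  by move=> x; rewrite divr_ge0 ?(ltW (a0 x)) ?(ltW (b0 _)).
rewrite (wprod_powR (u := a)); last by move=> x; exact: ltW.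
rewrite (wprod_powR (u := q)); last by move=> x; exact: ltW.
rewrite (wprod_powR (u := b)); last by move=> x; exact: ltW.
rewrite mulrACA -!powRM ?mulr_ge0 ?powR_ge0 ?(ltW wp0) ?(ltW wq0) ?(ltW wb0)//; last first.
  by apply: prodr_ge0 => x _; rewrite divr_ge0 ?(ltW (a0 x)) ?(ltW (b0 _)).
congr (_ `^ _ * _ `^ _); first by rewrite /sq_weight; ring.
rewrite /sq_ratio invfM invrK [RHS]mulrC; congr (_ * _).
rewrite wprodM wprod_map mulrC; congr (_ * _).
rewrite /wprod prodfV.
by [].
Qed.

Lemma mass_le s : sq s ->
  wprod cell_mass s.1 * wprod col_mass s.2 <= W s `^ t.
Proof.
rewrite (sqE cs) massE => /and3P[_ h _].
rewrite ger_pMr ?powR_gt0 ?(sq_weight_gt0 r cs)//.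
rewrite -[leRHS](_ : 1 `^ beta = 1); last by rewrite powR1.
have h0 := sq_ratio_gt0 cs s.1.
apply: ge0_ler_powR => //; rewrite ?nnegrE ?ler01//.
  by rewrite divr_ge0 ?(ltW h0) ?ltW ?wprod_gt0.
by rewrite ler_pdivrMr// mul1r ltW.
Qed.

Lemma mass_ge s : sq s ->
  e `^ beta * W s `^ t <= wprod cell_mass s.1 * wprod col_mass s.2.
Proof.
rewrite (sqE cs) massE mulrC => h.
rewrite ler_pM2l ?powR_gt0 ?(sq_weight_gt0 r cs)//.
have h0 := sq_ratio_gt0 cs s.1.
apply: ge0_ler_powR => //; rewrite ?nnegrE ?(ltW e0)//.
  by rewrite divr_ge0 ?(ltW h0) ?ltW ?wprod_gt0.
rewrite ler_pdivlMr//; apply: crossing_lb h => //; last exact: ltW.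
by move=> j; case/andP: (cs_b cs j).
Qed.

(** For fixed [w] the admissible tails form a complete prefix code: every column word of length [K]
    begins with exactly one of them. *)
Lemma tail_mass l K (w : l.-tuple T) : (1 - e) ^+ K < e ^+ l ->
  \sum_(y : K.-bseq U | sq (val w, val y)) wprod col_mass (val y) = 1.
Proof.
move=> Kl; have wl : size (val w) = l by rewrite size_tuple.
transitivity (wsum col_mass K (fun x =>
    \sum_(y : K.-bseq U | sq (val w, val y)) (prefix (val y) x)%:R)).
  rewrite wsum_sum; apply: eq_bigr => y _.
  by rewrite wsum_prefix ?size_bseq//; exact: col_mass_ge0.
rewrite -[RHS](wsum_cst beta_eq K).
apply: eq_wsum => x xK.
have [||s [ss sw pw px]] := @sq_free_ex _ _ _ _ _ _ _ _ _ cs l K (val w) x l Kl wl.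
- by rewrite xK.
- by [].
have {sw pw} sw : s.1 = val w.
  by move: pw; rewrite prefixE sw take_oversize ?wl// => /eqP.
have sK : (size s.2 <= K)%N by rewrite -xK size_prefix.
have sE : s = (val w, val (Bseq sK)) by rewrite [LHS]surjective_pairing sw.
rewrite (bigD1 (Bseq sK)) /=; last by rewrite -sE.
rewrite px big1 ?addr0// => y /andP[sy yne].
case yx: (prefix (val y) x) => //; exfalso; move/negP: yne; apply.
apply/eqP/val_inj => /=.
rewrite sE in ss.
have h1 := sq_chain_free cs sy ss (prefix_refl _) yx px.
have h2 := sq_chain_free cs ss sy (prefix_refl _) px yx.
by move: h1; rewrite prefixE => /eqP <-; rewrite take_oversize// size_prefix.
Qed.

(** By [tail_mass] the power of the sum is exactly the total mass of level [l]; [mass_le] and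
    [mass_ge] compare masses with weights. *)
Lemma level_sum_bounds l K : (1 - e) ^+ K < e ^+ l ->
  (\sum_x cell_mass x) ^+ l <=
    \sum_(w : l.-tuple T) \sum_(y : K.-bseq U | sq (val w, val y))
      W (val w, val y) `^ t <=
  (e `^ beta)^-1 * (\sum_x cell_mass x) ^+ l.
Proof.
move=> Kl; have E : (\sum_x cell_mass x) ^+ l = \sum_(w : l.-tuple T)
    \sum_(y : K.-bseq U | sq (val w, val y))
      wprod cell_mass (val w) * wprod col_mass (val y).
  rewrite -wsum_exp -wsum_tuple; apply: eq_bigr => w _.
  by rewrite -big_distrr/= tail_mass.
rewrite E; apply/andP; split.
  by apply: ler_sum => w _; apply: ler_sum => y ss; exact: (mass_le ss).
rewrite big_distrr/=; apply: ler_sum => w _; rewrite big_distrr/=.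
apply: ler_sum => y ss; rewrite mulrC ler_pdivlMr ?powR_gt0// mulrC.
exact: (mass_ge ss).
Qed.

End PressureMeasures.

(** The constants contribute [ln c / l] and [ln C / l], which vanish in the limit; the index is
    shifted to start from 1. *)
Lemma geometric_growth (R : realType) (Phi c C : R) (S : nat -> R) :
  0 < Phi -> 0 < c -> 0 < C ->
  (forall l, c * Phi ^+ l <= S l <= C * Phi ^+ l) ->
  (fun l : nat => l%:R^-1 * ln (S l)) @ \oo --> ln Phi.
Proof.
move=> Phi0 c0 C0 SP.
have lim (k : R) : 0 < k ->
    (fun l : nat => l.+1%:R^-1 * ln (k * Phi ^+ l.+1)) @ \oo --> ln Phi.
  move=> k0; rewrite (_ : (fun _ => _) = fun l => ln k * harmonic l + ln Phi).
    rewrite -[X in _ --> X]add0r -(mulr0 (ln k)).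
    by apply: cvgD; [apply: cvgMl_tmp; exact: cvg_harmonic|exact: cvg_cst].
  apply/funext => l; rewrite lnM ?posrE ?exprn_gt0// lnXn// /harmonic/=.
  by rewrite mulrDr -[ln Phi *+ _]mulr_natl mulKf ?pnatr_eq0// mulrC.
rewrite -(@cvg_shiftS _ (fun l : nat => l%:R^-1 * ln (S l)))/=.
apply: squeeze_cvgr (lim _ c0) (lim _ C0).
apply: nearW => l /=; have /andP[h1 h2] := SP l.+1.
have h0 : 0 < c * Phi ^+ l.+1 by rewrite mulr_gt0 ?exprn_gt0.
have S0 := lt_le_trans h0 h1.
by rewrite !ler_pM2l ?invr_gt0 ?ltr0n// !ler_ln ?posrE ?h1 ?h2 ?h0 ?S0 ?(lt_le_trans S0 h2).
Qed.

(** * Geometry of the carpet *)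

Section Link.
Context {R : realType} {m : nat} {n : 'I_m -> nat}.
Context (a c p : G n -> R) (b d : 'I_m -> R).

Lemma sum_column (F : G n -> R) j :
  \sum_(g | tag g == j) F g = \sum_(i < n j) F (idx i).
Proof.
transitivity (\sum_(j' | j' == j) \sum_(i < n j') F (idx i)).
  rewrite (sig_big_dep (pred1 j) (fun _ _ => true) (fun j i => F (idx i)))/=.
  by apply: eq_big => [g|[j' i]] //=; rewrite andbT.
by rewrite big_pred1_eq.
Qed.

(** The bound on the tails turns the finitely supported sum into a double sum over finite types. *)
Lemma Psi_sum_level r s l K :
  (forall x, sq tag a b x -> size x.1 = l -> (size x.2 <= K)%N) ->
  Psi_sum a b p r s l =
  \sum_(w : l.-tuple (G n)) \sum_(y : K.-bseq 'I_m | sq tag a b (val w, val y))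
    sq_weight a p (qvec p) r (val w, val y) `^ (s / (s + r)).
Proof.
move=> sK.
rewrite (pair_big_dep xpredT (fun (w : l.-tuple (G n)) (y : K.-bseq 'I_m) =>
  sq tag a b (val w, val y)) (fun w y =>
    sq_weight a p (qvec p) r (val w, val y) `^ (s / (s + r))))/=.
rewrite [RHS]bigfs ?index_enum_uniq//; last by move=> x _; rewrite mem_index_enum.
pose h (x : l.-tuple (G n) * K.-bseq 'I_m) := (x.1, val x.2).
rewrite /Psi_sum (reindex_fsbig h [set` fun x => sq tag a b (val x.1, val x.2)])//.
have sqP (w : l.-tuple (G n)) y : Psi a b (w, y) <-> sq tag a b (val w, y).
  rewrite /Psi /sq /crossing /sq_word /word_y /=.
  split=> [[/eqP y0 h1 h2]|/andP[y0 /and3P[_ h1 h2]]].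
    by rewrite h1 h2 !andbT; case: y y0 {h1 h2} => //= j y _; rewrite /nilp size_cat addnS.
  by split => //; move/nilP: y0.
split.
- by move=> [w y] /= sx; apply: (proj2 (sqP w (val y))).
- by move=> [w y] [w' y'] _ _ [-> /val_inj ->].
- move=> [w y] /sqP sx.
  have yK : (size y <= K)%N by apply: (sK _ sx); rewrite size_tuple.
  by exists (w, Bseq yK).
Qed.

Lemma finite_positive_lb (T : finType) (g : T -> R) : (forall x, 0 < g x) ->
  exists2 e, 0 < e & forall x, e <= g x.
Proof.
move=> g0; exists (\big[Num.min/1]_x g x).
  exact: lt_bigmin.
by move=> x; exact: bigmin_le.
Qed.

Hypothesis hG : lg_params a c b d.
Hypothesis hp : prob_vector p.

Lemma other_column (j : 'I_m) : exists j' : 'I_m, j' != j.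
Proof.
have m2 := lg_m hG; have m0 : (0 < m)%N by exact: ltnW.
have [->|ne] := eqVneq j (Ordinal m2); last by exists (Ordinal m2); rewrite eq_sym.
by exists (Ordinal m0).
Qed.

Lemma qvec_gt0 j : 0 < qvec p j.
Proof.
rewrite /qvec; have nj := lg_n hG j; rewrite (bigD1 (Ordinal nj))//=.
rewrite ltr_pwDl ?(hp.1)// sumr_ge0// => i _.
by rewrite ltW ?(hp.1).
Qed.

Lemma sum_qvec : \sum_j qvec p j = 1.
Proof.
rewrite -(hp.2) (partition_big tag xpredT)//=.
by apply: eq_bigr => j _; rewrite sum_column.
Qed.

Lemma lt1_of_sum (g : 'I_m -> R) j : (forall j, 0 < g j) -> \sum_j g j <= 1 ->
  g j < 1.
Proof.
move=> g0; rewrite (bigD1 j)//=; have [j' jj'] := other_column j.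
rewrite (bigD1 j')//=; have := g0 j'.
have : 0 <= \sum_(i < m | (i != j) && (i != j')) g i.
  by apply: sumr_ge0 => i _; rewrite ltW.
lra.
Qed.

Lemma lg_column_system : exists e, column_system tag a b p (qvec p) e.
Proof.
have b1 j : b j < 1 by apply: lt1_of_sum (lg_b_sum hG); exact: (lg_b_gt0 hG).
have q1 j : qvec p j < 1.
  by apply: lt1_of_sum qvec_gt0 _; rewrite sum_qvec.
have ab (g : G n) : a g < b (tag g) by case: g => j i; exact: (lg_a_lt_b hG i).
have [e1 e10 h1] := finite_positive_lb (lg_a_gt0 hG).
have [e2 e20 h2] := finite_positive_lb (lg_b_gt0 hG).
have [|e3 e30 h3] := @finite_positive_lb _ (fun j => 1 - b j); first by move=> j; rewrite subr_gt0.
have [e4 e40 h4] := finite_positive_lb hp.1.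
have [e5 e50 h5] := finite_positive_lb qvec_gt0.
have [|e6 e60 h6] := @finite_positive_lb _ (fun j => 1 - qvec p j); first by move=> j; rewrite subr_gt0.
(* The margin gives [a g <= b (tag g) - e], which is at most [(1 - e) * b (tag g)] as [b < 1]. *)
have [|e7 e70 h7] := @finite_positive_lb _ (fun g => b (tag g) - a g); first by move=> g; rewrite subr_gt0.
have [e [e0 ee]] : exists e, 0 < e /\ [&& e <= e1, e <= e2, e <= e3, e <= e4, e <= e5,
    e <= e6 & e <= e7].
  exists (Num.min e1 (Num.min e2 (Num.min e3 (Num.min e4 (Num.min e5 (Num.min e6 e7)))))).
  split; first by rewrite !lt_min e10 e20 e30 e40 e50 e60.
  by rewrite !ge_min !lexx !orbT.
case/and5P: ee => ee1 ee2 ee3 ee4 /and3P[ee5 ee6 ee7].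
have m0 : (0 < m)%N by exact: ltnW (lg_m hG).
exists e; split.
- rewrite e0 /=; have := h3 (Ordinal m0); have := lg_b_gt0 hG (Ordinal m0); lra.
- move=> g; rewrite (le_trans ee1)//=; have := h7 g; have := b1 (tag g).
  have := lg_b_gt0 hG (tag g); nra.
- by move=> j; have := h2 j; have := h3 j; lra.
- by move=> g; exact: le_trans (h4 g).
- by move=> j; have := h5 j; have := h6 j; lra.
- exact: hp.2.
- by move=> j; rewrite sum_column.
Qed.

End Link.

Section AffineWords.
Context {R : realType} {T : Type} (al ga : T -> R).

Definition affw (w : seq T) (x : R) : R := foldr (fun t x => al t * x + ga t) x w.

Lemma affw_cat w w' x : affw (w ++ w') x = affw w (affw w' x).
Proof. by rewrite /affw foldr_cat. Qed.

Lemma affwB w x y : affw w x - affw w y = wprod al w * (x - y).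
Proof.
elim: w => [|t w IH]; first by rewrite wprod_nil mul1r.
by rewrite wprod_cons -mulrA -IH /=; ring.
Qed.

Hypothesis al_gt0 : forall t, 0 < al t.

Lemma affw_mono w x y : x <= y -> affw w x <= affw w y.
Proof. by move=> xy; rewrite -subr_ge0 affwB mulr_ge0 ?subr_ge0// ltW// wprod_gt0. Qed.

Context (A B : R).
Hypothesis A_inv : forall t, A <= al t * A + ga t.
Hypothesis B_inv : forall t, al t * B + ga t <= B.

Lemma affw_ge w x : A <= x -> A <= affw w x.
Proof.
move=> Ax; apply: le_trans (affw_mono w Ax).
elim: w => //= t w IH; apply: le_trans (A_inv t) _.
by rewrite lerD2r ler_pM2l.
Qed.

Lemma affw_le w x : x <= B -> affw w x <= B.
Proof.
move=> xB; apply: le_trans (affw_mono w xB) _.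
elim: w => //= t w IH; apply: le_trans (B_inv t).
by rewrite lerD2r ler_pM2l.
Qed.

End AffineWords.

(** Distinct first letters of the same colour [phi] would give disjoint open intervals, so the
    letters agree and [x] is pulled back by their common map. The colour is the column horizontally
    and constant vertically. *)
Lemma affw_sep (R : realType) (T U : eqType) (phi : T -> U) (al ga : T -> R) (A B : R) :
  (forall t, 0 < al t) -> (forall t, A <= al t * A + ga t) ->
  (forall t, al t * B + ga t <= B) -> A <= B ->
  (forall t t', phi t = phi t' -> t != t' ->
     al t * B + ga t <= al t' * A + ga t' \/ al t' * B + ga t' <= al t * A + ga t) ->
  forall w w' x, prefix (map phi w) (map phi w') ->
    affw al ga w A < x < affw al ga w B ->
    affw al ga w' A < x < affw al ga w' B -> prefix w w'.
Proof.
move=> al0 Ai Bi AB dis; elim=> [|t w IH] [|t' w'] //= x /andP[/eqP tt' ww'].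
move=> /andP[h1 h2] /andP[h3 h4].
have bd s z : al s * A + ga s <= al s * affw al ga z A + ga s /\
    al s * affw al ga z B + ga s <= al s * B + ga s.
  by split; rewrite lerD2r ler_pM2l//; [exact: affw_ge|exact: affw_le].
have [ett|ne] := eqVneq t t'; last first.
  have [h5 h6] := bd t w; have [h7 h8] := bd t' w'.
  by case: (dis _ _ tt' ne); lra.
subst t'; rewrite /= (IH w' ((x - ga t) / al t))//.
- by rewrite ltr_pdivlMr// ltr_pdivrMr//; apply/andP; split; lra.
- by rewrite ltr_pdivlMr// ltr_pdivrMr//; apply/andP; split; lra.
Qed.

Lemma prefix_map_tt (T : eqType) (w w' : seq T) : (size w <= size w')%N ->
  prefix (map (fun=> tt) w) (map (fun=> tt) w').
Proof. by elim: w w' => [|t w IH] [|t' w'] //= /IH ->. Qed.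

Section ConcreteIntervals.
Context {R : realType} {m : nat} {n : 'I_m -> nat}.
Context (a c : G n -> R) (b d : 'I_m -> R).
Hypothesis hG : lg_params a c b d.

Lemma chain_lt N (x s : 'I_N -> R) : (forall i, 0 < x i) ->
  (forall i i' : 'I_N, i' = i.+1 :> nat -> x i + s i <= s i') ->
  forall i i' : 'I_N, (i < i')%N -> x i + s i <= s i'.
Proof.
move=> x0 next i [k kN] /=; elim: k kN => // k IH kN; rewrite ltnS leq_eqVlt.
have kN' : (k < N)%N by exact: ltnW.
case/orP => [/eqP ik|ik]; first by apply: next; rewrite /= ik.
apply: le_trans (IH kN' ik) _.
have := next (Ordinal kN') (Ordinal kN) erefl; have := x0 (Ordinal kN'); lra.
Qed.

Lemma chain_le1 N (x s : 'I_N -> R) : (forall i, 0 < x i) ->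
  (forall i i' : 'I_N, i' = i.+1 :> nat -> x i + s i <= s i') ->
  (forall i : 'I_N, i.+1 = N -> x i <= 1 - s i) ->
  forall i : 'I_N, x i + s i <= 1.
Proof.
move=> x0 next last i.
have lastN : (N.-1 < N)%N by case: N i {x s x0 next last} => [[]|].
have lastE : N.-1.+1 = N by rewrite prednK// (leq_trans _ (ltn_ord i)).
have lastb := last (Ordinal lastN) lastE.
have : (i <= N.-1)%N by rewrite -ltnS lastE.
rewrite leq_eqVlt => /orP[/eqP iN|iN].
  by have := last i; rewrite iN lastE => /(_ erefl); lra.
have := chain_lt x0 next (i' := Ordinal lastN) iN; have := x0 (Ordinal lastN).
lra.
Qed.

Lemma column_gap (j j' : 'I_m) : (j < j')%N -> b j + d j <= d j'.
Proof. by apply: chain_lt; [exact: (lg_b_gt0 hG)|exact: (lg_d_next hG)]. Qed.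

Lemma column_le1 j : b j + d j <= 1.
Proof.
apply: chain_le1; [exact: (lg_b_gt0 hG)|exact: (lg_d_next hG)|].
by move=> i im; have := lg_d_last hG im; lra.
Qed.

Lemma cell_gap j (i i' : 'I_(n j)) : (i < i')%N ->
  a (idx i) + c (idx i) <= c (idx i').
Proof.
apply: (chain_lt (x := fun i => a (idx i)) (s := fun i => c (idx i))).
  by move=> k; exact: (lg_a_gt0 hG).
exact: (lg_c_next hG).
Qed.

Lemma cell_le1 g : a g + c g <= 1.
Proof.
case: g => j i.
apply: (chain_le1 (x := fun i => a (idx i)) (s := fun i => c (idx i))).
- by move=> k; exact: (lg_a_gt0 hG).
- exact: (lg_c_next hG).
- exact: (lg_c_last hG).
Qed.

Lemma same_column (g g' : G n) : tag g = tag g' -> g != g' ->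
  a g + c g <= c g' \/ a g' + c g' <= c g.
Proof.
case: g g' => j i [j' i'] /= jj'; subst j' => ne.
have : (i != i' :> nat) by apply: contraNneq ne => /val_inj ->.
by rewrite neq_ltn => /orP[/cell_gap|/cell_gap]; [left|right].
Qed.

(** The unit interval has to be enlarged when every horizontal map fixes the
    same endpoint, because the carpet then lies on a side of the square. *)
Lemma horizontal_interval : exists A B gs,
  [/\ A < B, (forall g, A <= a g * A + c g), (forall g, a g * B + c g <= B),
   (forall g g' : G n, tag g = tag g' -> g != g' ->
     a g * B + c g <= a g' * A + c g' \/ a g' * B + c g' <= a g * A + c g) &
   A < affw a c gs A /\ affw a c gs B < B].
Proof.
have a0 := lg_a_gt0 hG; have c0 := lg_c_ge0 hG; have ac1 := cell_le1.
have a1 g : a g < 1.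
  case: g => j i; apply: (lt_trans (lg_a_lt_b hG i)).
  by have := column_le1 j; have := lg_d_gt0 hG j; lra.
have m0 : (0 < m)%N by exact: ltnW (lg_m hG).
pose j0 := Ordinal m0; pose g0 : G n := idx (Ordinal (lg_n hG j0)).
have unit_dis (g g' : G n) : tag g = tag g' -> g != g' ->
     a g * 1 + c g <= a g' * 0 + c g' \/ a g' * 1 + c g' <= a g * 0 + c g.
  by rewrite !mulr1 !mulr0 !add0r; exact: same_column.
have unit0 g : 0 <= a g * 0 + c g by rewrite mulr0 add0r.
have unit1 g : a g * 1 + c g <= 1 by rewrite mulr1.
(* First case: the image under one cell avoids both ends of the unit interval. *)
have [[g [cg acg]]|none] := pselect (exists g, 0 < c g /\ a g + c g < 1).
  by exists 0, 1, [:: g]; split => //=; rewrite mulr0 mulr1 add0r.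
have ends g : c g = 0 \/ a g + c g = 1.
  have [cg|cg] := ltP 0 (c g); last by left; apply/eqP; rewrite eq_le cg c0.
  right; apply/eqP; rewrite eq_le ac1/= leNgt; apply/negP => acg.
  by apply: none; exists g.
(* Second case: composing a map that fixes 0 with one that fixes 1 moves the image off both ends. *)
have [[g [g' [cg ag']]]|none2] :=
    pselect (exists g g', c g = 0 /\ a g' + c g' = 1).
  exists 0, 1, [:: g; g']; split => //=.
  rewrite cg mulr0 [a g' * 1]mulr1 ag' mulr1 add0r !addr0; split; last exact: a1.
  by rewrite mulr_gt0//; have := a1 g'; lra.
(* Now all maps fix 0 or all fix 1, and each column has a single cell because two would overlap. In
   [[-1, 1]], respectively [[0, 2]], the fixed point is interior. *)
have [c00|ac01] := ends g0.
  have cz g : c g = 0 by case: (ends g) => // ag; case: none2; exists g0, g.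
  exists (- 1), 1, [:: g0]; split => //=; rewrite ?cz.
  - by move=> g; rewrite cz; have := a1 g; lra.
  - move=> g g' tt ne; exfalso; have := a0 g; have := a0 g'.
    by case: (same_column tt ne); rewrite !cz; lra.
  - by have := a1 g0; lra.
have ac g : a g + c g = 1 by case: (ends g) => // cg; case: none2; exists g, g0.
exists 0, 2, [:: g0]; split => //=.
- by move=> g; have := ac g; have := a1 g; lra.
- move=> g g' tt ne; exfalso; have := ac g; have := ac g'; have := a0 g; have := a0 g'.
  by case: (same_column tt ne); lra.
- by have := ac g0; have := a1 g0; lra.
Qed.

Lemma vertical_dis (j j' : 'I_m) : j != j' ->
  b j * 1 + d j <= b j' * 0 + d j' \/ b j' * 1 + d j' <= b j * 0 + d j.
Proof.
rewrite !mulr1 !mulr0 !add0r -val_eqE /= neq_ltn => /orP[] /column_gap; by [left|right].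
Qed.

(** The first column works: [d > 0] keeps it above 0, and the second column keeps it below 1. *)
Lemma vertical_interior : exists j, 0 < d j /\ b j + d j < 1.
Proof.
have m2 := lg_m hG; have m0 : (0 < m)%N by exact: ltnW.
exists (Ordinal m0); split; first exact: (lg_d_gt0 hG).
have := @column_gap (Ordinal m0) (Ordinal m2) isT.
by have := column_le1 (Ordinal m2); have := lg_b_gt0 hG (Ordinal m2); lra.
Qed.

Lemma word_map_lg (w : seq (G n)) (z : R * R) :
  word_map (lg_map a c b d) w z = (affw a c w z.1, affw b d (map tag w) z.2).
Proof. by elim: w => [|g w /= ->] //; case: z. Qed.

End ConcreteIntervals.

(** * Integral bounds through approximate squares *)

Section Carpet.
Context {R : realType} {m : nat} {n : 'I_m -> nat}.
Context (a c p : G n -> R) (b d : 'I_m -> R) (mu : probability (plane R) R).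
Context (r e A B : R).
Hypothesis hG : lg_params a c b d.
Hypothesis hp : prob_vector p.
Hypothesis hmu : self_affine a c b d p mu.
Hypothesis r_gt0 : 0 < r.
Hypothesis cs : column_system tag a b p (qvec p) e.
Hypothesis AB : A < B.
Hypothesis A_inv : forall g, A <= a g * A + c g.
Hypothesis B_inv : forall g, a g * B + c g <= B.

Let e0 : 0 < e. Proof. by case/andP: (cs_e cs). Qed.
Let e1 : e < 1. Proof. by case/andP: (cs_e cs). Qed.
Let a0 : forall g, 0 < a g := lg_a_gt0 hG.
Let b0 : forall j, 0 < b j := lg_b_gt0 hG.
Let p0 : forall g, 0 < p g := hp.1.
Let a1 g : a g <= 1 - e.
Proof. by have := cs_a cs g; have := cs_b cs (tag g); have := e0; nra. Qed.
Let d0 j : 0 <= b j * 0 + d j.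
Proof. by rewrite mulr0 add0r ltW// (lg_d_gt0 hG). Qed.
Let d1 j : b j * 1 + d j <= 1.
Proof. by rewrite mulr1 (column_le1 hG). Qed.

Local Notation q := (qvec p).
Local Notation W := (sq_weight a p q r).
Local Notation sq := (sq tag a b).
Local Notation yword := (sq_word tag).

Definition box : set (plane R) :=
  [set z : plane R | A <= z.1 <= B /\ 0 <= z.2 <= 1].

Lemma measurable_lg_map g :
  measurable_fun setT (lg_map a c b d g : plane R -> plane R).
Proof.
apply/measurable_fun_pairP; split => /=.
  by apply: measurable_funD => //; exact: measurable_funM.
by apply: measurable_funD => //; exact: measurable_funM.
Qed.

(** A signed distance to [box]; each map shrinks a nonnegative bound on it by [1 - e], as
    [contracting_excess_ae0] requires. *)
Definition box_excess (z : plane R) : R :=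
  Num.max (Num.max (A - z.1) (z.1 - B)) (Num.max (- z.2) (z.2 - 1)).

Lemma measurable_box_excess : measurable_fun setT box_excess.
Proof.
by do ![apply: measurable_maxr]; do ?[exact: measurable_funB|exact: measurableT_comp].
Qed.

Lemma boxE : box = [set z | box_excess z <= 0].
Proof.
apply/seteqP; split => z /=; rewrite /box_excess !ge_max !subr_le0 oppr_le0.
  by move=> [/andP[-> ->] /andP[-> ->]].
by move=> /andP[/andP[h1 h2] /andP[h3 h4]]; rewrite /box/= h1 h2 h3 h4.
Qed.

Lemma measurable_box : measurable box.
Proof.
rewrite boxE -[X in measurable X]setTI.
rewrite (_ : [set z | _] = box_excess @^-1` `]-oo, 0]%classic).
  exact: measurable_box_excess.
by apply/seteqP; split => z /=; rewrite in_itv.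
Qed.

Lemma mu_box : mu box = 1%E.
Proof.
rewrite boxE; apply: (contracting_excess_ae0 (k := 1 - e) _ (cs_p1 cs)
  measurable_lg_map hmu measurable_box_excess).
- by move=> g; exact: ltW.
- by have := e0; have := e1; lra.
move=> g z t t_ge0; rewrite /box_excess /lg_map !ge_max /=.
move=> /andP[/andP[h1 h2] /andP[h3 h4]].
have := ler_wpM2r t_ge0 (a1 g); have := ler_wpM2r t_ge0 (andP (cs_b cs (tag g))).2.
have := ler_wpM2l (ltW (a0 g)) h1; have := ler_wpM2l (ltW (a0 g)) h2.
have := ler_wpM2l (ltW (b0 (tag g))) h3; have := ler_wpM2l (ltW (b0 (tag g))) h4.
have := A_inv g; have := B_inv g; have := d0 (tag g); have := d1 (tag g).
lra.
Qed.

Definition corner (s : seq (G n) * seq 'I_m) : R * R :=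
  (affw a c s.1 A, affw b d (yword s) 0).

Definition open_sq (s : seq (G n) * seq 'I_m) (z : R * R) : bool :=
  (affw a c s.1 A < z.1 < affw a c s.1 B) &&
  (affw b d (yword s) 0 < z.2 < affw b d (yword s) 1).

(** The square has width [(B - A) * wprod a s.1], and the stopping rule makes its height less than
    [wprod a s.1]. *)
Lemma dist_corner s w z : sq s -> prefix s.1 w -> prefix (yword s) (map tag w) ->
  box z ->
  eucl_dist (word_map (lg_map a c b d) w z) (corner s) <= (B - A + 1) * wprod a s.1.
Proof.
move=> /andP[_ /and3P[_ ss _]] /prefixP[w' wE] /prefixP[y yE] [/andP[z1 z2] /andP[z3 z4]].
rewrite word_map_lg mulrDl mul1r; apply: eucl_dist_le => /=.
  rewrite wE affw_cat affwB normrM ger0_norm ?(ltW (wprod_gt0 _ a0))//.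
  rewrite mulrC ler_wpM2r ?(ltW (wprod_gt0 _ a0))// ger0_norm ?subr_ge0.
    by rewrite lerB// affw_le.
  exact: affw_ge.
rewrite yE affw_cat affwB normrM ger0_norm ?(ltW (wprod_gt0 _ b0))//.
rewrite subr0 ger0_norm; last exact: affw_ge.
apply: le_trans (ltW ss); rewrite -[leRHS]mulr1.
by rewrite ler_wpM2l ?(ltW (wprod_gt0 _ b0))// affw_le.
Qed.

(** The vertical coordinate makes the column words comparable, hence also the columns of the cells;
    the horizontal one then makes the cells agree, and the stopping rule orders the column words. *)
Lemma open_sq_chain s s' z :
  (forall g g' : G n, tag g = tag g' -> g != g' ->
     a g * B + c g <= a g' * A + c g' \/ a g' * B + c g' <= a g * A + c g) ->
  sq s -> sq s' -> open_sq s z -> open_sq s' z -> (size s.1 <= size s'.1)%N ->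
  prefix s.1 s'.1 /\ prefix (yword s) (yword s').
Proof.
move=> dis ss ss' /andP[x1 y1] /andP[x2 y2] ll.
have ysep y y' : affw b d y 0 < z.2 < affw b d y 1 ->
    affw b d y' 0 < z.2 < affw b d y' 1 -> (size y <= size y')%N -> prefix y y'.
  move=> h h' /prefix_map_tt h2; apply: (affw_sep _ _ _ _ _ h2 h h') => //.
  by move=> j j' _; exact: (vertical_dis hG).
have comp : prefix (yword s) (yword s') \/ prefix (yword s') (yword s).
  have [h|/ltnW h] := leqP (size (yword s)) (size (yword s')).
    by left; exact: ysep h.
  by right; exact: ysep h.
have tt : prefix (map tag s.1) (map tag s'.1).
  case: comp => h.
    apply: (prefix_comparable (x := yword s')); rewrite ?size_map ?prefix_prefix//.
    exact: prefix_trans (prefix_prefix _ _) h.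
  apply: (prefix_comparable (x := yword s)); rewrite ?size_map ?prefix_prefix//.
  exact: prefix_trans (prefix_prefix _ _) h.
have pp : prefix s.1 s'.1 by apply: (affw_sep _ _ _ _ dis tt x1 x2) => //; exact: ltW.
by split => //; exact: (sq_chain_geo cs ss ss' pp comp).
Qed.

Lemma card_open_sq_le (L K M k : nat) (eta : R) z (S : {pred L.-bseq (G n) * K.-bseq 'I_m}) :
  (forall g g' : G n, tag g = tag g' -> g != g' ->
     a g * B + c g <= a g' * A + c g' \/ a g' * B + c g' <= a g * A + c g) ->
  0 < eta -> decay e r ^+ M <= step_cst e r k ->
  (forall s, s \in S -> in_band tag a b p q e r k eta (decode s)) ->
  (forall s, s \in S -> open_sq (decode s) z) -> (#|S| <= M)%N.
Proof.
move=> dis eta0 Mc Sb Sz.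
have Ssq s : s \in S -> sq (decode s) by move=> /Sb /andP[].
have ch s s' : s \in S -> s' \in S -> (size (decode s).1 <= size (decode s').1)%N ->
    prefix (decode s).1 (decode s').1 /\ prefix (yword (decode s)) (yword (decode s')).
  by move=> Ss Ss'; exact: open_sq_chain (Ssq _ Ss) (Ssq _ Ss') (Sz _ Ss) (Sz _ Ss').
apply: (@leq_card_chain R _ S (fun s => size (decode s).1) (fun s => W (decode s))
  (decay e r) (step_cst e r k * eta) eta M).
- by rewrite (decay_gt0 r cs)//= ltW// (decay_lt1 cs).
- exact: ltW.
- by rewrite ler_pM2r.
- by move=> s /Sb /andP[].
- move=> s s' Ss Ss' ll; have [/prefixP[w' E] yy] := ch _ _ Ss Ss' ll.
  have E' : decode s' = ((decode s).1 ++ w', (decode s').2) by rewrite -E.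
  rewrite E' in yy *; rewrite size_cat addKn.
  exact: (sq_decay_geo cs r_gt0).
- move=> s s' Ss Ss' ll; apply: decode_inj.
  have [p1 y1] := ch _ _ Ss Ss' (eq_leq ll).
  have [_ y2] := ch _ _ Ss' Ss (eq_leq (esym ll)).
  have x12 : (decode s).1 = (decode s').1.
    by move: p1; rewrite prefixE ll take_size => /eqP.
  have y12 : yword (decode s) = yword (decode s').
    by move: y1; rewrite prefixE => /eqP <-; rewrite take_oversize// size_prefix.
  rewrite [decode s]surjective_pairing [decode s']surjective_pairing x12.
  congr (_, _); move: y12; rewrite /sq_word x12.
  by move/eqP; rewrite eqseq_cat// eqxx => /eqP.
Qed.

Let measurable_dist_powR (alpha : set (R * R)) : alpha !=set0 -> finite_set alpha ->
  measurable_fun setT (fun x : plane R => dist_set x alpha `^ r).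
Proof.
move=> h1 h2; apply: (measurableT_comp (measurable_powR r)).
exact: measurable_dist_set.
Qed.

(** Every word of length [L + K] passes through a band square. With the corners as centres, each
    square costs a constant times its mass times the power [r] of its width, that is, a constant
    times its weight, which is below [eta]. *)
Lemma integral_cover_le (L K k : nat) (eta : R) :
  0 < eta <= e -> (1 - e) ^+ k <= e -> (1 - e) ^+ K < e ^+ L ->
  decay e r ^+ L < eta ->
  let S := [pred s : L.-bseq (G n) * K.-bseq 'I_m | in_band tag a b p q e r k eta (decode s)] in
  exists alpha : set (R * R), [/\ alpha !=set0, (alpha #<= `I_#|S|)%card &
    (\int[mu]_x (dist_set x alpha `^ r)%:E <=
     ((B - A + 1) `^ r * (#|S|%:R * eta))%:E)%E].
Proof.
move=> etae ke KL Leta S.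
have D0 : 0 <= B - A + 1 by rewrite addr_ge0// subr_ge0 ltW.
have cov w : size w = (L + K)%N -> exists s : L.-bseq (G n) * K.-bseq 'I_m,
    [/\ S s, prefix (decode s).1 w & prefix (yword (decode s)) (map tag w)].
  move=> wN; have [||s [sL sb sw sy]] := geo_band_ex cs r_gt0 ke etae KL Leta (w := w).
  - by rewrite wN leq_addr.
  - by rewrite wN leq_addl.
  have [|s' s'E] := decode_ex sL (s := s) (K := K).
    by case/andP: sb => ss _; exact: (sq_size cs KL sL ss).
  by exists s'; rewrite s'E; split => //; rewrite /S /= [X in in_band _ _ _ _ _ _ _ _ _ X]s'E.
have m0 : (0 < m)%N by exact: ltnW (lg_m hG).
pose g0 : G n := idx (Ordinal (lg_n hG (Ordinal m0))).
have [s0 [Ss0 _ _]] := cov (nseq (L + K) g0) (size_nseq _ _).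
pose alpha : set (R * R) := (fun i => corner (decode (nth s0 (enum S) i))) @` `I_#|S|.
have alphaP s : S s -> alpha (corner (decode s)).
  move=> Ss; have sS : s \in enum S by rewrite mem_enum.
  exists (index s (enum S)); last by rewrite nth_index.
  by rewrite /= cardE index_mem.
have alpha0 : alpha !=set0 by exists (corner (decode s0)); exact: alphaP.
have alphaS : (alpha #<= `I_#|S|)%card by exact: card_image_le.
exists alpha; split => //.
(* Summing over all band squares along [w] avoids choosing one of them. *)
pose hi w := \sum_(s | S s) ((B - A + 1) * wprod a (decode s).1) `^ r *
  (prefix (decode s).1 w && prefix (yword (decode s)) (map tag w))%:R.
apply: (@le_trans _ _ (wsum p (L + K) hi)%:E).
  apply: (integral_le_wsum (fun g => ltW (p0 g)) measurable_lg_map hmu measurable_box mu_box).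
  - by apply: measurable_dist_powR => //; exact: (card_le_finite alphaS).
  - by move=> x; exact: powR_ge0.
  - by move=> w; apply: sumr_ge0 => s _; rewrite mulr_ge0 ?powR_ge0.
  move=> w z wN zQ; have [s [Ss sw sy]] := cov _ wN.
  rewrite /hi (bigD1 s)//= sw sy mulr1 -[leLHS]addr0 lerD//; last first.
    by apply: sumr_ge0 => i _; rewrite mulr_ge0 ?powR_ge0.
  apply: ge0_ler_powR; rewrite ?nnegrE ?(ltW r_gt0) ?dist_set_ge0//.
    by rewrite mulr_ge0// ltW// wprod_gt0.
  apply: le_trans (dist_set_le _ (alphaP _ Ss)) _.
  by apply: dist_corner => //; case/andP: Ss.
rewrite lee_fin /hi wsum_sum.
apply: (@le_trans _ _ (\sum_(s in S) (B - A + 1) `^ r * eta)); last first.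
  by rewrite sumr_const -mulrnAr mulr_natl.
apply: ler_sum => s /andP[_ /andP[_ Ws]].
rewrite wsumZ (wsum_prefix_map (cs_p1 cs) (cs_pq cs)); last first.
  by rewrite leq_add// size_bseq.
rewrite powRM//; last by rewrite ltW// wprod_gt0.
rewrite -mulrA ler_wpM2l ?powR_ge0//; apply: le_trans (ltW Ws).
by rewrite /sq_weight mulrC.
Qed.

(** The word [gs] moves the point away from the vertical sides of the square, the
    column [j] away from the horizontal ones. *)
Lemma dist_free s w z del gs j (alpha : set (R * R)) :
  sq s -> 0 < del -> A + del <= affw a c gs A -> affw a c gs B <= B - del ->
  del <= e * d j -> del <= e * (1 - (b j + d j)) ->
  prefix (s.1 ++ gs) w -> prefix (yword s ++ [:: j]) (map tag w) -> box z ->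
  open_sq s (word_map (lg_map a c b d) w z) /\
  (alpha !=set0 -> (forall y, alpha y -> ~~ open_sq s y) ->
   del * wprod a s.1 <= dist_set (word_map (lg_map a c b d) w z) alpha).
Proof.
move=> /andP[_ ss] del0 gA gB dj1 dj2 /prefixP[w' wE] /prefixP[y yE].
move=> [/andP[z1 z2] /andP[z3 z4]]; rewrite word_map_lg /open_sq.
have as0 := wprod_gt0 s.1 a0; have by0 := wprod_gt0 (yword s) b0.
(* The height is at least [e * wprod a s.1], hence the factor [e] in the conditions on [del]. *)
have ab : e * wprod a s.1 <= wprod b (yword s).
  apply: crossing_lb ss => //; last exact: ltW.
  by move=> i; case/andP: (cs_b cs i).
set X := affw a c w z.1; set Y := affw b d (map tag w) z.2.
have [hX1 hX2] : affw a c s.1 A + del * wprod a s.1 <= X /\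
    X <= affw a c s.1 B - del * wprod a s.1.
  rewrite /X wE -catA affw_cat; set u := affw a c (gs ++ w') z.1.
  have u1 : A + del <= u.
    apply: (le_trans gA); rewrite /u affw_cat; apply: affw_mono => //.
    exact: affw_ge.
  have u2 : u <= B - del.
    apply: le_trans gB; rewrite /u affw_cat; apply: affw_mono => //.
    exact: affw_le.
  have := affwB a c s.1 u A; have := affwB a c s.1 B u.
  have : wprod a s.1 * del <= wprod a s.1 * (u - A) by rewrite ler_pM2l//; lra.
  have : wprod a s.1 * del <= wprod a s.1 * (B - u) by rewrite ler_pM2l//; lra.
  by rewrite ![wprod a s.1 * del]mulrC; lra.
have [hY1 hY2] : affw b d (yword s) 0 + del * wprod a s.1 <= Y /\
    Y <= affw b d (yword s) 1 - del * wprod a s.1.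
  rewrite /Y yE -catA (affw_cat b d (yword s)) /=; set v' := affw b d y z.2.
  have v1 : 0 <= v' by apply: affw_ge.
  have v2 : v' <= 1 by apply: affw_le.
  set v := b j * v' + d j.
  have h1 : d j <= v by rewrite lerDr mulr_ge0// ltW.
  have h2 : v <= b j + d j by rewrite lerD2r ger_pMr.
  have := affwB b d (yword s) v 0; have := affwB b d (yword s) 1 v.
  have key k : del <= e * k -> 0 <= k -> del * wprod a s.1 <= wprod b (yword s) * k.
    move=> dk k0; apply: (@le_trans _ _ (e * k * wprod a s.1)).
      by rewrite ler_pM2r.
    by rewrite mulrAC ler_wpM2r.
  have dj0 : 0 <= d j by rewrite ltW// (lg_d_gt0 hG).
  have bd1 : 0 <= 1 - (b j + d j) by rewrite subr_ge0 (column_le1 hG).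
  have := key _ dj1 dj0; have := key _ dj2 bd1.
  have : wprod b (yword s) * d j <= wprod b (yword s) * (v - 0) by rewrite ler_pM2l//; lra.
  have : wprod b (yword s) * (1 - (b j + d j)) <= wprod b (yword s) * (1 - v).
    by rewrite ler_pM2l//; lra.
  lra.
have k0 : 0 < del * wprod a s.1 by rewrite mulr_gt0.
split; first by apply/andP; split; apply/andP; split => /=; lra.
move=> alpha0 out; apply: le_dist_set => // u /out.
rewrite !negb_and -!leNgt => hu; apply: eucl_dist_ge; first exact: ltW.
have big (x x' : R) : x' + del * wprod a s.1 <= x \/ x + del * wprod a s.1 <= x' ->
    del * wprod a s.1 <= `|x - x'|.
  by move=> [h|h]; [rewrite ger0_norm|rewrite ler0_norm]; lra.
by case/orP: hu => /= /orP[] h; [left|left|right|right]; apply: big;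
  [left|right|left|right]; lra.
Qed.

(** The points of [alpha] meet at most [M * N] open squares, which leaves at least [M * N] free ones
    in [S]. In each, the part following [gs] and ending in column [j] stays away from [alpha] and
    keeps a fixed fraction of the mass. *)
Lemma integral_free_ge (L K M k : nat) (eta del : R) (gs : seq (G n)) (j : 'I_m)
    (alpha : set (R * R)) (N : nat) :
  (forall g g' : G n, tag g = tag g' -> g != g' ->
     a g * B + c g <= a g' * A + c g' \/ a g' * B + c g' <= a g * A + c g) ->
  0 < eta -> decay e r ^+ M <= step_cst e r k -> (0 < M)%N ->
  0 < del -> A + del <= affw a c gs A -> affw a c gs B <= B - del ->
  del <= e * d j -> del <= e * (1 - (b j + d j)) ->
  alpha !=set0 -> (alpha #<= `I_N)%card ->
  let S := [pred s : L.-bseq (G n) * K.-bseq 'I_m |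
    in_band tag a b p q e r k eta (decode s) && prefix (map tag gs) (decode s).2] in
  (2 * (M * N) <= #|S|)%N ->
  ((del `^ r * (wprod p gs * q j) * (step_cst e r k * eta * N%:R))%:E <=
    \int[mu]_x (dist_set x alpha `^ r)%:E)%E.
Proof.
move=> dis eta0 Mc M0 del0 gA gB dj1 dj2 alpha0 alphaN S SN.
have fin_alpha : finite_set alpha by exact: (card_le_finite alphaN).
pose zs : seq (R * R) := finmap.enum_fset (fset_set alpha).
have zsE : alpha = [set` zs] by rewrite -[LHS](fset_setK fin_alpha).
have zsN : (size zs <= N)%N by exact: geq_card_fset_set.
pose hit (s : L.-bseq (G n) * K.-bseq 'I_m) := has (open_sq (decode s)) zs.
pose F := [pred s | S s && ~~ hit s].
have FN : (M * N <= #|F|)%N.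
  have hitN : (#|[pred s | S s && hit s]| <= M * N)%N.
    rewrite -sum1_card big_mkcondr /=.
    apply: (@leq_trans (\sum_(s | S s) \sum_(z <- zs) open_sq (decode s) z)).
      apply: leq_sum => s _; case: ifP => // /hasP[z zzs oz].
      by rewrite (big_rem z)//= oz.
    rewrite exchange_big /=.
    apply: (@leq_trans (\sum_(z <- zs) M)).
      apply: leq_sum => z _; rewrite -big_mkcondr /= sum1_card.
      apply: (card_open_sq_le (k := k) dis eta0 Mc (z := z)).
        by move=> s /andP[/andP[]].
      by move=> s /andP[].
    by rewrite big_const_seq count_predT iter_addn_0 leq_mul2l zsN orbT.
  have SE : #|S| = (#|[pred s | S s && hit s]| + #|F|)%N.
    by rewrite -!sum1_card (bigID hit).
  have := leq_trans SN (eq_leq SE); rewrite mul2n -addnn => h.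
  by have := leq_trans h (leq_add hitN (leqnn _)); rewrite leq_add2l.
have Fout s : F s -> forall y, alpha y -> ~~ open_sq (decode s) y.
  move=> /andP[_ /hasPn h] y; rewrite zsE => yzs; exact: h.
pose cond (s : L.-bseq (G n) * K.-bseq 'I_m) (w : seq (G n)) := prefix ((decode s).1 ++ gs) w &&
  prefix (yword (decode s) ++ [:: j]) (map tag w).
(* A point lies in at most [M] of these open squares, so dividing the sum by [M] makes it a lower
   bound. *)
pose lo (w : seq (G n)) := M%:R^-1 * \sum_(s | F s)
  (del * wprod a (decode s).1) `^ r * (cond s w)%:R.
have M0' : 0 < M%:R :> R by rewrite ltr0n.
have C0 : 0 < del `^ r * (wprod p gs * q j).
  by rewrite mulr_gt0 ?powR_gt0// mulr_gt0 ?wprod_gt0// (qvec_gt0 hG hp).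
(* [s.1] takes at most [L] letters, [gs] with the rest of the tail at most [K], and the column [j]
   one more. *)
apply: (@le_trans _ _ (wsum p (L + K).+1 lo)%:E); last first.
  apply: (integral_ge_wsum (fun g => ltW (p0 g)) measurable_lg_map hmu measurable_box mu_box).
  - exact: measurable_dist_powR.
  - by move=> x; exact: powR_ge0.
  - move=> w; rewrite mulr_ge0 ?invr_ge0// sumr_ge0// => s _.
    by rewrite mulr_ge0 ?powR_ge0.
  move=> w z _ zQ; rewrite /lo mulrC ler_pdivrMr//.
  set P := word_map _ w z.
  have P0 : 0 <= dist_set P alpha by exact: dist_set_ge0.
  apply: (@le_trans _ _ (\sum_(s | F s && cond s w) dist_set P alpha `^ r)).
    rewrite [leRHS]big_mkcondr; apply: ler_sum => s Fs; case: ifP => cw; last by rewrite mulr0.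
    rewrite mulr1; have /andP[/andP[/andP[ss _] _] _] := Fs.
    have /andP[cw1 cw2] := cw.
    have [_ h] := dist_free alpha ss del0 gA gB dj1 dj2 cw1 cw2 zQ.
    apply: ge0_ler_powR; rewrite ?nnegrE ?(ltW r_gt0)//.
      by rewrite mulr_ge0 ?ltW ?wprod_gt0.
    by apply: h => // y; exact: Fout.
  rewrite (eq_bigl (mem [pred s | F s && cond s w]))// sumr_const.
  rewrite -[leLHS]mulr_natr.
  rewrite ler_wpM2l ?powR_ge0// ler_nat.
  apply: (card_open_sq_le (k := k) dis eta0 Mc (z := P)).
    by move=> s /andP[/andP[/andP[]]].
  move=> s /andP[/andP[/andP[/andP[ss _] _] _] /andP[cw1 cw2]].
  by have [] := dist_free alpha ss del0 gA gB dj1 dj2 cw1 cw2 zQ.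
rewrite lee_fin /lo wsumZ wsum_sum mulrC ler_pdivlMl//.
apply: (@le_trans _ _ (\sum_(s in F)
    del `^ r * (wprod p gs * q j) * (step_cst e r k * eta))).
  rewrite sumr_const -[leRHS]mulr_natr.
  rewrite [leLHS](_ : _ = del `^ r * (wprod p gs * q j) * (step_cst e r k * eta) * (M * N)%:R).
    by rewrite ler_wpM2l ?ler_nat// mulr_ge0 ?(ltW C0)// mulr_ge0 ?(ltW eta0)// ltW// (step_cst_gt0 r cs).
  by rewrite natrM; ring.
apply: ler_sum => s /andP[/andP[/andP[_ /andP[Ws _]] /prefixP[y yE]] _].
rewrite wsumZ powRM ?(ltW del0)//; last by rewrite ltW ?wprod_gt0.
(* The tail begins with the columns of [gs], so once these cells are fixed only the columns [y ++
   [:: j]] remain prescribed. *)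
have -> : wsum p (L + K).+1 (fun w => (cond s w)%:R) =
    wprod p ((decode s).1 ++ gs) * wprod q (y ++ [:: j]).
  rewrite -(@wsum_prefix_map _ _ _ tag p q (cs_p1 cs) (cs_pq cs) (L + K).+1); last first.
    have := size_bseq s.1; have := size_bseq s.2.
    rewrite -[size s.2]/(size (decode s).2) yE !size_cat size_map /= addn1 => h1 h2.
    by rewrite addnS ltnS -addnA leq_add.
  apply: eq_wsum => w _; rewrite /cond /sq_word yE map_cat -!catA.
  by [].
rewrite !wprod_cat wprod_seq1.
apply: (@le_trans _ _ (del `^ r * (wprod p gs * q j) * W (decode s))).
  by rewrite ler_wpM2l// ltW.
rewrite /sq_weight yE wprod_cat.
have q01 i : 0 < q i < 1 by have := cs_q cs i; have := e0; lra.
have := wprod_le1 (map tag gs) q01.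
have wy := wprod_gt0 y (qvec_gt0 hG hp); have wp := wprod_gt0 (decode s).1 p0.
have wg := wprod_gt0 gs p0; have wj := qvec_gt0 hG hp j.
have wa : 0 < wprod a (decode s).1 `^ r by rewrite powR_gt0 ?wprod_gt0.
have wd : 0 < del `^ r by rewrite powR_gt0.
move=> h; rewrite [leLHS](_ : _ = del `^ r * wprod a (decode s).1 `^ r *
  (wprod p (decode s).1 * wprod p gs * (wprod q y * q j)) * wprod q (map tag gs)).
  by rewrite ger_pMr// !mulr_gt0.
by ring.
Qed.

End Carpet.

(** * Quantization coefficients *)

Lemma limn_esup_le_near (R : realType) (u : (\bar R)^nat) (x : \bar R) (n0 : nat) :
  (forall k, (n0 <= k)%N -> (u k <= x)%E) -> (limn_esup u <= x)%E.
Proof.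
move=> h; apply: (@le_trans _ _ (ereal_sup [set u k | k in [set k | (n0 <= k)%N]])).
  by apply: ereal_inf_lbound; exists [set k | (n0 <= k)%N] => //; exact: nbhs_infty_ge.
by apply: ge_ereal_sup => _ [k /= nk <-]; exact: h.
Qed.

Lemma limn_einf_ge_near (R : realType) (u : (\bar R)^nat) (x : \bar R) (n0 : nat) :
  (forall k, (n0 <= k)%N -> (x <= u k)%E) -> (x <= limn_einf u)%E.
Proof.
move=> h; rewrite /limn_einf leeNr; apply: (@limn_esup_le_near _ _ _ n0) => k nk.
by rewrite leeN2 h.
Qed.

Section QuantizationError.
Context {R : realType} (mu : probability (plane R) R) (r : R).
Hypothesis r_gt0 : 0 < r.

Let poweR_rK (x : \bar R) : (0 <= x)%E -> ((x `^ r^-1) `^ r)%E = x.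
Proof. by move=> x0; rewrite -poweRrM mulVf ?gt_eqF// poweRe1. Qed.

Let le_poweR (x y : \bar R) (t : R) : (0 <= x)%E -> (x <= y)%E -> 0 <= t ->
  (x `^ t <= y `^ t)%E.
Proof.
move=> x0 xy t0; apply: gt0_ler_poweR; rewrite ?in_itv/= ?leey ?andbT//.
exact: le_trans xy.
Qed.

Let int_ge0 alpha : (0 <= \int[mu]_x (dist_set x alpha `^ r)%:E)%E.
Proof. by apply: integral_ge0 => x _; rewrite lee_fin powR_ge0. Qed.

Lemma quant_err_ge0 k : (0 <= quant_err mu r k)%E.
Proof. by apply: le_ereal_inf_tmp => _ [alpha _ <-]; exact: poweR_ge0. Qed.

Lemma quant_err_le k (alpha : set (R * R)) (X : R) : alpha !=set0 ->
  (alpha #<= `I_k)%card ->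
  (\int[mu]_x (dist_set x alpha `^ r)%:E <= X%:E)%E ->
  (quant_err mu r k `^ r <= X%:E)%E.
Proof.
move=> a0 ak aX; apply: le_trans aX; rewrite -[leRHS]poweR_rK//.
apply: le_poweR => //; [exact: quant_err_ge0| |exact: ltW].
by apply: ereal_inf_lbound; exists alpha.
Qed.

Lemma quant_err_ge k (X : R) : 0 <= X ->
  (forall alpha : set (R * R), alpha !=set0 -> (alpha #<= `I_k)%card ->
    (X%:E <= \int[mu]_x (dist_set x alpha `^ r)%:E)%E) ->
  (X%:E <= quant_err mu r k `^ r)%E.
Proof.
move=> X0 h; rewrite -[leLHS]poweR_rK//.
apply: le_poweR => //; [exact: poweR_ge0| |exact: ltW].
apply: le_ereal_inf_tmp => _ [alpha [a0 ak] <-].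
by apply: le_poweR; rewrite ?invr_ge0 ?(ltW r_gt0)//; exact: h.
Qed.

End QuantizationError.

Section Scale.
Context {R : realType} (r s : R).
Hypotheses (r_gt0 : 0 < r) (s_gt0 : 0 < s).

(** Chosen so that its power [s / (s + r)] is [k / N]: at this [eta] the band holds about [N]
    words. *)
Definition scale (k : R) (N : nat) : R := (k / N%:R) `^ ((s + r) / s).

Lemma scale_gt0 k N : 0 < k -> (0 < N)%N -> 0 < scale k N.
Proof. by move=> k0 N0; rewrite powR_gt0// divr_gt0// ltr0n. Qed.

Lemma scale_powR k N : 0 <= k -> scale k N `^ (s / (s + r)) = k / N%:R.
Proof.
move=> k0; rewrite /scale -powRrM.
have -> : (s + r) / s * (s / (s + r)) = 1.
  by rewrite mulrA divfK ?gt_eqF// divff// gt_eqF// addr_gt0.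
by rewrite powRr1// divr_ge0.
Qed.

(** The powers of [N] cancel because [r / s + 1 = (s + r) / s]. *)
Lemma scale_normalized k N : 0 < k -> (0 < N)%N ->
  N%:R `^ (r / s) * (N%:R * scale k N) = k `^ ((s + r) / s).
Proof.
move=> k0 N0; have N0' : 0 < N%:R :> R by rewrite ltr0n.
have E : N%:R `^ (r / s) * N%:R = N%:R `^ ((s + r) / s).
  rewrite mulrDl divff ?gt_eqF// addrC powRD ?powRr1//.
  by apply/implyP => _; rewrite gt_eqF.
rewrite mulrA E /scale -powRM ?divr_ge0 ?ltW//.
by rewrite mulrC divfK// gt_eqF.
Qed.

Lemma scale_small k eps : 0 < k -> 0 < eps ->
  exists n0, forall N, (n0 <= N)%N -> (0 < N)%N /\ scale k N < eps.
Proof.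
move=> k0 eps0; set z := eps `^ ((s + r) / s)^-1.
have z0 : 0 < z by rewrite powR_gt0.
exists (Num.truncn (k / z)).+1 => N hN; have N0 : (0 < N)%N by exact: leq_trans hN.
split => //; have N0' : 0 < N%:R :> R by rewrite ltr0n.
have kz : k / N%:R < z.
  rewrite ltr_pdivrMr// mulrC -ltr_pdivrMr//.
  by apply: lt_le_trans (truncnS_gt _) _; rewrite ler_nat.
have -> : eps = z `^ ((s + r) / s).
  by rewrite /z -powRrM mulVf ?gt_eqF ?divr_gt0 ?addr_gt0// powRr1// ltW.
by apply: gt0_ltr_powR; rewrite ?nnegrE ?divr_ge0 ?(ltW z0) ?(ltW k0)// divr_gt0// addr_gt0.
Qed.

End Scale.

Section MainBounds.
Context {R : realType} {m : nat} {n : 'I_m -> nat}.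
Context (a c p : G n -> R) (b d : 'I_m -> R) (mu : probability (plane R) R).
Context (r s : R).
Hypothesis hG : lg_params a c b d.
Hypothesis hp : prob_vector p.
Hypothesis hmu : self_affine a c b d p mu.
Hypothesis r_gt0 : 0 < r.
Hypothesis s_gt0 : 0 < s.
Hypothesis hlim :
  (fun l : nat => l%:R^-1 * ln (Psi_sum a b p r s l)) @ \oo --> (0 : R).

Let t : R := s / (s + r).

Let t01 : 0 < t < 1.
Proof.
rewrite /t divr_gt0 ?addr_gt0//= ltr_pdivrMr ?addr_gt0// mul1r ltrDl.
exact: r_gt0.
Qed.

(** The level sums grow like powers of [Phi], so the limit assumed to be 0 equals [ln Phi]. *)
Let pressure_zero e beta : column_system tag a b p (qvec p) e -> 0 <= beta ->
  \sum_j qvec p j `^ t * b j `^ beta = 1 ->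
  \sum_g cell_mass tag a b p r t beta g = 1.
Proof.
move=> cs beta0 betaE; set Phi := \sum_g _.
have [e0 e1] : 0 < e /\ e < 1 by apply/andP; exact: cs_e cs.
have m0 : (0 < m)%N by exact: ltnW (lg_m hG).
pose g0 : G n := idx (Ordinal (lg_n hG (Ordinal m0))).
have Phi0 : 0 < Phi.
  rewrite /Phi (bigD1 g0)//=; apply: ltr_pwDl; first exact: (cell_mass_gt0 r t cs).
  by apply: sumr_ge0 => g _; exact: cell_mass_ge0.
have eb : 0 < e `^ beta by rewrite powR_gt0.
have lim : (fun l : nat => l%:R^-1 * ln (Psi_sum a b p r s l)) @ \oo --> ln Phi.
  apply: (@geometric_growth R Phi 1 (e `^ beta)^-1); rewrite ?invr_gt0// => l.
  have [||K KL] := @expr_lt_ex R (1 - e) (e ^+ l); first by lra.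
    by rewrite exprn_gt0.
  rewrite (@Psi_sum_level _ _ _ a p b r s l K); last first.
    by move=> x sx xl; apply: (sq_size cs KL _ sx); rewrite xl.
  rewrite mul1r.
  exact: (level_sum_bounds r cs beta0 betaE KL).
have /eqP : 0 = ln Phi by exact: cvg_unique hlim lim.
by rewrite eq_sym ln_eq0// => /eqP.
Qed.

Lemma quantization_bounds : exists n0 C1 C2, 0 < C1 /\ forall N, (n0 <= N)%N ->
  (C1%:E <= quant_seq mu r s N <= C2%:E)%E.
Proof.
have [e cs] := lg_column_system hG hp.
have [e0 e1] : 0 < e /\ e < 1 by apply/andP; exact: cs_e cs.
have [A [B [gs [AB A_inv B_inv dis [gA gB]]]]] := horizontal_interval hG.
have [j [dj0 dj1]] := vertical_interior hG.
have [beta beta0 betaE] := column_exponent_ex cs t01.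
pose u := cell_mass tag a b p r t beta; pose v := col_mass b (qvec p) t beta.
have u1 : \sum_g u g = 1 by exact: (pressure_zero cs beta0 betaE).
have u0 g : 0 <= u g by exact: cell_mass_ge0.
have v0 i : 0 <= v i by exact: col_mass_ge0.
have [||k /ltW ke] := @expr_lt_ex R (1 - e) e; [lra|by []|].
have c00 := step_cst_gt0 r cs k.
have [||M0 /ltW M0c] := @expr_lt_ex R (decay e r) (step_cst e r k).
- by rewrite (decay_lt1 cs)// (ltW (decay_gt0 r cs)).
- exact: c00.
(* The successor makes [M] positive, since it is a divisor below. *)
pose M := M0.+1; have M0' : 0 < M%:R :> R by rewrite ltr0n.
have Mc : decay e r ^+ M <= step_cst e r k.
  apply: le_trans M0c; rewrite exprS ler_piMl ?exprn_ge0 ?(ltW (decay_gt0 r cs))//.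
  exact: ltW (decay_lt1 cs r_gt0).
have eb : 0 < e `^ beta by rewrite powR_gt0.
have ct : 0 < step_cst e r k `^ t by rewrite powR_gt0.
have t0 : 0 <= t by case/andP: t01 => /ltW.
pose h := map tag gs; pose vh := wprod v h.
have vh0 : 0 < vh by apply: wprod_gt0 => i; exact: (col_mass_gt0 t cs).
have [eta0 eta00 tail] := long_tail cs r_gt0 (size h).
pose del := Num.min (Num.min (affw a c gs A - A) (B - affw a c gs B))
  (Num.min (e * d j) (e * (1 - (b j + d j)))).
have del0 : 0 < del by rewrite !lt_min !subr_gt0 gA gB !mulr_gt0// subr_gt0.
have [del1 del2 del3 del4] : [/\ del <= affw a c gs A - A, del <= B - affw a c gs B,
    del <= e * d j & del <= e * (1 - (b j + d j))].
  by split; rewrite !ge_min lexx ?orbT.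
(* With [eta := scale r s k1 N], [card_band_le] gives at most [N] band words. *)
pose k1 := M%:R / (e `^ beta * step_cst e r k `^ t).
have k10 : 0 < k1 by rewrite divr_gt0// mulr_gt0.
(* With [eta := scale r s k2 N], [card_band_ge] gives at least [2 * (M * N)] band words whose tails
   extend [h]. *)
pose k2 := vh / (2 * M%:R).
have k20 : 0 < k2 by rewrite divr_gt0// mulr_gt0.
have [n1 hn1] := scale_small r_gt0 s_gt0 k10 e0.
have [|n2 hn2] := scale_small r_gt0 s_gt0 k20 (eps := Num.min e eta0).
  by rewrite lt_min e0.
have LK eta : 0 < eta -> exists L K, [/\ (1 - e) ^+ K < e ^+ L, decay e r ^+ L < eta &
    (size h <= K)%N].
  move=> eta_gt0; have [|L hL] := @expr_lt_ex R (decay e r) eta _ eta_gt0.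
    by rewrite (decay_lt1 cs)// (ltW (decay_gt0 r cs)).
  have [||K hK] := @expr_lt_ex R (1 - e) (e ^+ L); [lra|by rewrite exprn_gt0|].
  exists L, (K + size h)%N; split; rewrite ?leq_addl//.
  by apply: le_lt_trans hK; apply: ler_wiXn2l; rewrite ?leq_addr//; lra.
pose C1 := del `^ r * (wprod p gs * qvec p j) * step_cst e r k * k2 `^ ((s + r) / s).
pose C2 := (B - A + 1) `^ r * k1 `^ ((s + r) / s).
have D0 : 0 < del `^ r * (wprod p gs * qvec p j).
  apply: mulr_gt0; first by rewrite powR_gt0.
  by rewrite mulr_gt0 ?(qvec_gt0 hG hp)// wprod_gt0//; exact: hp.1.
exists (maxn n1 n2), C1, C2; split.
  by apply: mulr_gt0; [exact: mulr_gt0|rewrite powR_gt0].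
move=> N; rewrite geq_max => /andP[/hn1[N0 eta1e] /hn2[_]].
rewrite lt_min => /andP[eta2e eta2t].
have NR0 : 0 < N%:R :> R by rewrite ltr0n.
have NP0 : 0 <= N%:R `^ (r / s) by exact: powR_ge0.
apply/andP; split.
- set eta := scale r s k2 N in eta2e eta2t.
  have eta_gt0 : 0 < eta by exact: scale_gt0.
  have [L [K [KL Leta hK]]] := LK _ eta_gt0.
  have -> : C1 = N%:R `^ (r / s) *
      (del `^ r * (wprod p gs * qvec p j) * (step_cst e r k * eta * N%:R)).
    by rewrite /C1 -(scale_normalized r s_gt0 k20 N0) -/eta; ring.
  rewrite EFinM /quant_seq; apply: lee_wpmul2l; first by rewrite lee_fin.
  apply: quant_err_ge => //.
    apply/ltW/(mulr_gt0 D0)/mulr_gt0 => //; exact: mulr_gt0.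
  move=> alpha alpha0 alphaN.
  apply: (integral_free_ge hG hp hmu r_gt0 cs AB A_inv B_inv (M := M) (L := L) (K := K)) => //.
  + lra.
  + lra.
  have tl s' : sq tag a b s' -> sq_weight a p (qvec p) r s' < eta ->
      (size h <= size s'.2)%N.
    by move=> ss Ws; apply: (tail _ ss); exact: lt_trans eta2t.
  have etae : 0 < eta <= e by rewrite eta_gt0 ltW.
  have := card_band_ge cs r_gt0 ke u0 v0 u1 betaE t0 etae KL Leta hK tl
    (fun s' ss => mass_le r t cs beta0 ss).
  rewrite (scale_powR r_gt0 s_gt0 _ (ltW k20)) -/vh.
  set cd := #|_|; rewrite /k2 mulrA ler_pdivlMr// mulrA ler_pdivlMr ?mulr_gt0//.
  rewrite -mulrA mulrC ler_pM2r// => hcd.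
  by rewrite -(ler_nat R) (_ : _%:R = N%:R * (2 * M%:R))// !natrM; ring.
- set eta := scale r s k1 N in eta1e.
  have eta_gt0 : 0 < eta by exact: scale_gt0.
  have etae : 0 < eta <= e by rewrite eta_gt0 ltW.
  have [L [K [KL Leta hK]]] := LK _ eta_gt0.
  have := integral_cover_le hG hp hmu r_gt0 cs AB A_inv B_inv etae ke KL Leta.
  have := card_band_le cs r_gt0 L K u0 v0 u1 betaE t0 eta_gt0 Mc (ltW eb)
    (fun s' ss => mass_ge r t cs beta0 ss).
  set S := [pred s0 | _]; set cd := #|_|.
  rewrite powRM ?(ltW c00) ?(ltW eta_gt0)// (scale_powR r_gt0 s_gt0 _ (ltW k10)).
  move=> cdM [alpha [alpha0 alphaS int_le]].
  have cdN : (cd <= N)%N.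
    rewrite -(ler_nat R).
    move: cdM; rewrite /k1.
    rewrite (_ : cd%:R * _ = cd%:R * M%:R / N%:R).
      by rewrite ler_pdivrMr// mulrC ler_pM2l.
    by field; rewrite ?gt_eqF.
  have -> : C2 = N%:R `^ (r / s) * ((B - A + 1) `^ r * (N%:R * eta)).
    by rewrite /C2 -(scale_normalized r s_gt0 k10 N0) -/eta; ring.
  rewrite EFinM /quant_seq; apply: lee_wpmul2l; first by rewrite lee_fin.
  apply: (quant_err_le r_gt0 alpha0).
    by apply: card_le_trans alphaS _; rewrite card_le_II.
  apply: le_trans int_le _; rewrite lee_fin ler_wpM2l ?powR_ge0//.
  by rewrite ler_pM2r// ler_nat.
Qed.

End MainBounds.

Unset Implicit Arguments.
Set Strict Implicit.

Theorem theorem1p2 (R : realType) (m : nat) (n : 'I_m -> nat)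
    (a c : G n -> R) (b d : 'I_m -> R) (p : G n -> R)
    (E : set (R * R)) (mu : probability (plane R) R) (r s : R)
    (hG : lg_params a c b d)
    (hE : is_carpet a c b d E)
    (hp : prob_vector p)
    (hmu : self_affine a c b d p mu)
    (hr : 0 < r)
    (hs : 0 < s)
    (hlim : (fun l : nat => l%:R^-1 * ln (Psi_sum a b p r s l)) @ \oo --> (0 : R)) :
  [/\ (0 < lower_quant_coeff mu r s)%E,
      (lower_quant_coeff mu r s <= upper_quant_coeff mu r s)%E &
      (upper_quant_coeff mu r s < +oo)%E].
Proof.
have [n0 [C1 [C2 [C10 bounds]]]] := quantization_bounds hG hp hmu hr hs hlim.
split.
- apply: (@lt_le_trans _ _ C1%:E); first by rewrite lte_fin.
  by apply: (@limn_einf_ge_near _ _ _ n0) => N /bounds /andP[].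
- exact: limn_einf_sup.
- apply: (@le_lt_trans _ _ C2%:E); last exact: ltry.
  by apply: (@limn_esup_le_near _ _ _ n0) => N /bounds /andP[].
Qed.
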